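(* Let $\alpha\in\mathbb{R}$ and $\alpha\notin\pi\mathbb{Z}$. (1) If $f\in e_{-\alpha}L^p(\mathbf{T}^n_\alpha)$, $1\le p<\infty$, then $$\lim_{N\to\infty}\big\| f\overset{\alpha}{\ast}F^n_N-f\big\|_{L^p(\mathbf{T}^n_\alpha)}=0.$$ (2) If $f\in e_{-\alpha}L^\infty(\mathbf{T}^n_\alpha)$ is uniformly continuous on a subset $K$ of $\mathbf{T}^n_\alpha$, then $$\lim_{N\to\infty}\big\| f\overset{\alpha}{\ast}F^n_N-f\big\|_{L^\infty(K)}=0.$$
   Context: Let $n\ge 1$ and $\alpha\in\mathbb{R}\setminus\pi\mathbb{Z}$. The fractional torus $\mathbf{T}^n_\alpha$ is the cube of side $|\sin\alpha|$ with opposite sides identified, represented by $[-|\sin\alpha|/2,|\sin\alpha|/2]^n$; functions on $\mathbf{T}^n_\alpha$ are functions on $\mathbb{R}^n$ that are $|\sin\alpha|$-periodic in each coordinate, equivalently functions on this cube, and integrals and $L^p$ norms over $\mathbf{T}^n_\alpha$ are taken over this cube with Lebesgue measure. Put $e_\alpha(x)=e^{\pi i|x|^2\cot\alpha}$ and $e_{-\alpha}(x)=e^{-\pi i|x|^2\cot\alpha}$. For $1\le p\le\infty$, $e_{-\alpha}L^p(\mathbf{T}^n_\alpha)$ is the space of functions $f=e_{-\alpha}g$ on the cube with $g\in L^p(\mathbf{T}^n_\alpha)$ and $\|f\|_{L^p(\mathbf{T}^n_\alpha)}<\infty$; for such $f$, $e_\alpha f$ denotes the periodic function $g$. $\mathbf{T}^n$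 is the standard torus (1-periodic functions). For $f\in e_{-\alpha}L^1(\mathbf{T}^n_\alpha)$ and $g\in L^1(\mathbf{T}^n)$, the fractional convolution of order $\alpha$ is $$(f\overset{\alpha}{\ast}g)(x)=|\csc\alpha|^n e_{-\alpha}(x)\int_{\mathbf{T}^n_\alpha}e_\alpha(y)f(y)\,g\big((x-y)\csc\alpha\big)\,dy .$$ $F^n_N$ is the classical Fejér kernel $F^n_N(x)=\prod_{j=1}^nF^1_N(x_j)$, $F^1_N(t)=\sum_{j=-N}^N\big(1-\frac{|j|}{N+1}\big)e^{2\pi i jt}$.
   Formalization: In (2), ''uniformly continuous on K'' means |f(x)-f(y)|<ε for x in K and all y in the torus near x, not only y in K; with y only in K it fails (α=π/2, f the indicator of K=[0,1/4]). Functions in L^p are taken Borel measurable. *)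

(* Defs.v *)
From HB Require Import structures.
From mathcomp Require Import all_boot all_order all_algebra.
From mathcomp Require Import all_classical all_reals all_analysis.
From mathcomp Require Import complex.

Set Implicit Arguments.
Unset Strict Implicit.
Unset Printing Implicit Defensive.

Import Order.TTheory GRing.Theory Num.Theory.
Import numFieldNormedType.Exports.

Local Open Scope classical_set_scope.
Local Open Scope ring_scope.

(* R^n, with the product sigma-algebra of the Borel sets of R *)
Notation Rn R n := (n.-tuple (measurableTypeR R)).

Definition consRn (R : realType) (n : nat) (z : measurableTypeR R * Rn R n)
  : Rn R n.+1 := [tuple of z.1 :: z.2].

Lemma measurable_consRn (R : realType) (n : nat) :
  measurable_fun [set: measurableTypeR R * Rn R n] (@consRn R n).
Proof.
by apply: measurable_cons; [exact: measurable_fst|exact: measurable_snd].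
Qed.

Section lebesgue_cons.
Local Open Scope ereal_scope.
Context (R : realType) (n : nat).
Variable m : {sigma_finite_measure set (Rn R n) -> \bar R}.

Definition lebesgue_cons : set (Rn R n.+1) -> \bar R :=
  pushforward (@lebesgue_measure R \x m) (@consRn R n).

Let m0 : lebesgue_cons set0 = 0.
Proof. by rewrite /lebesgue_cons /pushforward preimage_set0 measure0. Qed.

Let m_ge0 A : 0 <= lebesgue_cons A.
Proof. exact: (@measure_ge0 _ _ _ (@lebesgue_measure R \x m)). Qed.

Let m_additive : semi_sigma_additive lebesgue_cons.
Proof.
move=> F mF tF mUF; rewrite /lebesgue_cons /pushforward preimage_bigcup.
apply: measure_semi_sigma_additive.
- by move=> i; rewrite -[X in measurable X]setTI; exact: measurable_consRn.
- apply/trivIsetP => /= i j _ _ ij; rewrite -preimage_setI.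
  by move/trivIsetP : tF => /(_ _ _ _ _ ij) ->//; rewrite preimage_set0.
- rewrite -preimage_bigcup -[X in measurable X]setTI.
  exact: measurable_consRn.
Qed.

HB.instance Definition _ :=
  isMeasure.Build _ _ _ lebesgue_cons m0 m_ge0 m_additive.

Let m_sigma_finite : sigma_finite setT lebesgue_cons.
Proof.
have /sigma_finiteP[F [TF ndF Foo]] := sigma_finiteT (@lebesgue_measure R).
have /sigma_finiteP[G [TG ndG Goo]] := sigma_finiteT m.
pose split_ (x : Rn R n.+1) : measurableTypeR R * Rn R n :=
  (thead x, [tuple of behead x]).
have mS : measurable_fun [set: Rn R n.+1] split_.
  apply: measurable_fun_pair; first exact: measurable_tnth.
  exact: measurable_behead.
have preK A : @consRn R n @^-1` (split_ @^-1` A) = A.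
  rewrite -comp_preimage; apply/seteqP.
  have splitK z : split_ (consRn z) = z.
    case: z => a b; rewrite /split_ /consRn theadE; congr pair.
    exact: val_inj.
  by split=> z; rewrite /preimage /comp /= splitK.
exists (fun k => split_ @^-1` (F k `*` G k)).
  apply/seteqP; split=> // x _.
  have [k _ Fk] : (\bigcup_i F i) (split_ x).1 by rewrite -TF.
  have [l _ Gl] : (\bigcup_i G i) (split_ x).2 by rewrite -TG.
  exists (maxn k l) => //; split.
  - by move: Fk; apply/subsetPset/ndF/leq_maxl.
  - by move: Gl; apply/subsetPset/ndG/leq_maxr.
move=> k; have [? ?] := Foo k; have [? ?] := Goo k; split.
  by rewrite -[X in measurable X]setTI; apply: mS => //; exact: measurableX.
rewrite /lebesgue_cons /pushforward preK product_measure1E//.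
by rewrite lte_mul_pinfty// ge0_fin_numE.
Qed.

HB.instance Definition _ :=
  Measure_isSigmaFinite.Build _ _ _ lebesgue_cons m_sigma_finite.

End lebesgue_cons.

(* [lebesgueRn R n] is the n-fold product of the Lebesgue measure of R, carried
   to n-tuples. *)
Fixpoint lebesgueRn (R : realType) (n : nat)
    : {sigma_finite_measure set (Rn R n) -> \bar R} :=
  if n is k.+1 then lebesgue_cons (lebesgueRn R k)
  else dirac ([tuple] : Rn R 0).

Lemma lebesgueRn_box (R : realType) (n : nat)
    (A : 'I_n -> set (measurableTypeR R)) :
  (forall i, measurable (A i)) ->
  lebesgueRn R n [set x | forall i, A i (tnth x i)] =
  (\big[*%E/1%E]_(i < n) lebesgue_measure (A i))%E.
Proof.
elim: n A => [|n IH] A mA.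
  rewrite big_ord0 /= diracE mem_set//.
  by move=> [].
rewrite big_ord_recl -(IH (fun i => A (lift ord0 i)))// -product_measure1E//.
  rewrite /= /lebesgue_cons /pushforward; congr (_ _).
  apply/seteqP; split=> [[a b] /= h|[a b] /= [ha hb] i].
    split; first by have := h ord0; rewrite tnth0.
    by move=> i; have := h (lift ord0 i); rewrite tnthS.
  by case: (unliftP ord0 i) => [j ->|->]; rewrite ?tnthS ?tnth0.
rewrite (_ : [set _ | _] =
    \bigcap_(i in [set: 'I_n]) ((fun x => tnth x i) @^-1` A (lift ord0 i))).
  apply: fin_bigcap_measurable; first exact: finite_finset.
  move=> i _; rewrite -[X in measurable X]setTI.
  exact: measurable_tnth.
by apply/seteqP; split=> x /= h i; [move=> _; exact: h|exact: h].
Qed.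

Section complex_valued.
Variable R : realType.

(* e^{i t} for real t *)
Definition expi (t : R) : R[i] := (cos t +i* sin t)%C.

Definition cmeasurable_fun d (T : measurableType d) (D : set T)
    (h : T -> R[i]) : Prop :=
  measurable_fun D (fun x => complex.Re (h x)) /\
  measurable_fun D (fun x => complex.Im (h x)).

(* Lebesgue integral of a complex-valued function; meaningful when both real and
   imaginary parts are integrable. *)
Definition cintegral d (T : measurableType d)
    (mu : {measure set T -> \bar R}) (D : set T) (h : T -> R[i]) : R[i] :=
  ((\int[mu]_(x in D) complex.Re (h x)) +i*
   (\int[mu]_(x in D) complex.Im (h x)))%C.

(* The modulus of [h] is extended by 0 outside [D]: for [p = +oo] this gives the
   essential supremum of the modulus over [D], also for a nonmeasurable [D]. *)
Definition Lnorm_on d (T : measurableType d)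
    (mu : {measure set T -> \bar R}) (p : \bar R) (D : set T)
    (h : T -> R[i]) : \bar R :=
  Lnorm mu p ((fun x => (Normc.normc (h x))%:E) \_ D).

End complex_valued.

Section fractional_torus.
Variable R : realType.

Definition sqnorm n (x : Rn R n) : R := \sum_(i < n) (tnth x i : R) ^+ 2.

Definition translate n (s : R) (k : 'I_n -> int) (x : Rn R n) : Rn R n :=
  [tuple (tnth x i : R) + (k i)%:~R * s | i < n].

Definition periodic_Rn n (s : R) (g : Rn R n -> R[i]) : Prop :=
  forall (k : 'I_n -> int) (x : Rn R n), g (translate s k x) = g x.

Definition cot (alpha : R) : R := cos alpha / sin alpha.
Definition csc (alpha : R) : R := (sin alpha)^-1.

Definition side (alpha : R) : R := `|sin alpha|.

Definition cube n (alpha : R) : set (Rn R n) :=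
  [set x | forall i, - (side alpha / 2) <= (tnth x i : R) <= side alpha / 2].

(* e_alpha and e_{-alpha} *)
Definition chirp n (alpha : R) (x : Rn R n) : R[i] :=
  expi (pi * sqnorm x * cot alpha).
Definition chirpN n (alpha : R) (x : Rn R n) : R[i] :=
  expi (- (pi * sqnorm x * cot alpha)).

Definition Lp_torus n (alpha : R) (p : \bar R) (g : Rn R n -> R[i]) : Prop :=
  [/\ periodic_Rn (side alpha) g,
      cmeasurable_fun setT g &
      (Lnorm_on (lebesgueRn R n) p (cube alpha) g < +oo)%E].

(* The space e_{-alpha} L^p(T^n_alpha). Its elements are functions on the cube:
   the values of [f] outside [cube alpha] play no role here or below. *)
Definition eLp n (alpha : R) (p : \bar R) (f : Rn R n -> R[i]) : Prop :=
  (exists2 g : Rn R n -> R[i], Lp_torus alpha p g &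
     forall x, cube alpha x -> f x = chirpN alpha x * g x) /\
  (Lnorm_on (lebesgueRn R n) p (cube alpha) f < +oo)%E.

Definition sub_csc n (alpha : R) (x y : Rn R n) : Rn R n :=
  [tuple ((tnth x i : R) - (tnth y i : R)) * csc alpha | i < n].

Definition fconv n (alpha : R) (f g : Rn R n -> R[i]) (x : Rn R n) : R[i] :=
  (`|csc alpha| ^+ n)%:C%C * chirpN alpha x *
  cintegral (lebesgueRn R n) (cube alpha)
    (fun y => chirp alpha y * f y * g (sub_csc alpha x y)).

(* The one-dimensional Fejer kernel; the index [k] stands for j + N. *)
Definition fejer1 (N : nat) (t : R) : R[i] :=
  \sum_(k < (2 * N).+1) let j : int := k%:Z - N%:Z in
    (1 - `|j|%:~R / N.+1%:R)%:C%C * expi (2 * pi * j%:~R * t).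

Definition fejer n (N : nat) (x : Rn R n) : R[i] :=
  \prod_(i < n) fejer1 N (tnth x i : R).

(* [x] and [y] are at distance less than [d] modulo s Z^n, in sup norm *)
Definition torus_close n (s d : R) (x y : Rn R n) : Prop :=
  exists k : 'I_n -> int, forall i,
    `|(tnth x i : R) - tnth (translate s k y) i| < d.

(* Uniform continuity of [f] on a subset [K] of the torus, meaning continuity at
   the points of [K], uniformly in that point: [y] ranges over the whole torus,
   not only over [K]. Uniform continuity of the restriction of [f] to [K] would
   not be enough: for the indicator function of an interval [K], the Fejer means
   tend to 1/2 at the endpoints. *)
Definition unif_cont_on n (alpha : R) (K : set (Rn R n))
    (f : Rn R n -> R[i]) : Prop :=
  forall e : R, 0 < e -> exists2 d : R, 0 < d &
    forall x y, K x -> cube alpha y -> torus_close (side alpha) d x y ->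
      Normc.normc (f x - f y) < e.

End fractional_torus.

(* Main.v *)
Require Import Defs.
From mathcomp Require Import all_boot all_order all_algebra.
From mathcomp Require Import all_classical all_reals all_analysis.
From mathcomp Require Import complex measurable_realfun ess_sup_inf.
From mathcomp Require Import ring lra zify.

Set Implicit Arguments.
Unset Strict Implicit.
Unset Printing Implicit Defensive.

Import Order.TTheory GRing.Theory Num.Theory.
Import numFieldNormedType.Exports.

Local Open Scope classical_set_scope.
Local Open Scope ring_scope.

(** Multiplication by the chirp turns the fractional convolution into an
    ordinary one.  On the cube write f = e_{-alpha} g.  Since the chirps have
    modulus one and cancel under the integral,
      f * F_N - f = e_{-alpha} (sigma_N g - g),
    where sigma_N g (x) is the integral of g (y) k_N (x, y) over the cube and
    k_N (x, y) is |csc alpha|^n times the product of the F_N ((x_i - y_i) csc alpha).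
    The dilation by csc alpha maps the side of the cube to one period, so k_N is
    a symmetric nonnegative kernel of mass 1 in each variable.  As k_N is real,
    the real and imaginary parts of g can be treated separately
    ([fconv_sub_le]).

    The kernel concentrates on the diagonal of the torus.  The closed form
    (N+1) F_N (t) sin^2 (pi t) = sin^2 ((N+1) pi t) shows that the gap
      sum_i sin^2 (pi (x_i - y_i) csc alpha),
    a function that vanishes exactly on the diagonal, has k_N-mean at most
    n / (N+1), uniformly in x ([integral_torus_gap]).

    L^p convergence.  By Jensen's inequality ([powR_jensen]) it suffices that
    the mean oscillation, the double integral of |g x - g y|^p k_N (x, y), tends
    to 0.  Functions with this property are stable under sums and under
    dominated limits, because k_N has mass 1 in both variables, so the sets
    whose indicator has it form a sigma-algebra.  It contains the half-spaces
    x_i < a: for x off finitely many null hyperplanes, the points y on the other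
    side of such a half-space are at positive distance from x on the torus, hence
    carry little kernel mass ([vanishing_osc_half_space]).  Half-spaces generate
    the Borel sets, and simple functions are dense in L^p.

    Uniform convergence.  If f is essentially bounded and is continuous at the
    points of K with a modulus that does not depend on the point, then
    |g x - g y| <= e + C gap (x, y) for x in K and almost all y, with C
    independent of x; taking k_N-means gives e + C n / (N+1). *)

(** * Trigonometric preliminaries *)

Section trigonometry.
Variable R : realType.
Implicit Types (t x : R).

Lemma sin_sqrDpi_int x (k : int) : sin (x + pi * k%:~R) ^+ 2 = sin x ^+ 2.
Proof.
have H n (y : R) : sin (y + pi * n%:R) ^+ 2 = sin y ^+ 2.
  by rewrite mulr_natr (alternatingn (@sinDpi R)) exprMn sqrr_sign mul1r.
case: k => n; first exact: H.
by rewrite -(H n.+1) NegzE rmorphN /= mulrN subrK.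
Qed.

Lemma nearest_int t : exists k : int,
  `|t - k%:~R| <= 2^-1 /\ sin (pi * t) ^+ 2 = sin (pi * `|t - k%:~R|) ^+ 2.
Proof.
exists (Num.floor (t + 2^-1)); set k := Num.floor _.
split.
  have := floor_itv (t + 2^-1); rewrite -/k intrD ler_norml; lra.
set r := t - k%:~R; have -> : sin (pi * `|r|) ^+ 2 = sin (pi * r) ^+ 2.
  by case: (ger0P r) => // _; rewrite mulrN sinN sqrrN.
by rewrite -[RHS](sin_sqrDpi_int _ k) /r; congr (sin _ ^+ 2); ring.
Qed.

Lemma sin_eq0_int x : sin x = 0 -> exists k : int, x = k%:~R * pi.
Proof.
move=> sx0; have pi0 := @pi_gt0 R; have [k [kle]] := nearest_int (x / pi).
rewrite mulrC divfK ?gt_eqF// sx0 expr0n => /esym/eqP; rewrite sqrf_eq0 => /eqP.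
set r := x / pi - k%:~R in kle *; have [r0 _|r0 s0] := eqVneq r 0.
  exists k; rewrite -(divfK (lt0r_neq0 pi0) x); congr (_ * _).
  by apply/eqP; rewrite -subr_eq0 -/r r0.
have : 0 < sin (pi * `|r|).
  have r1 : 0 < `|r| by rewrite normr_gt0.
  apply: sin_gt0_pi; rewrite mulr_gt0//= gtr_pMr//; lra.
by rewrite s0 ltxx.
Qed.

(** The square of sin (pi t) controls the distance of t to the integers, so that
    neighbourhoods of the diagonal of the torus can be described by it. *)
Lemma sin_sqr_separation (d : R) : 0 < d -> exists2 c : R, 0 < c &
  forall t, sin (pi * t) ^+ 2 < c -> exists k : int, `|t - k%:~R| < d.
Proof.
move=> d0; have pi0 := @pi_gt0 R.
(* The cap at 1/2 keeps pi d' where the sine increases. *)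
pose d' := Num.min d 2^-1.
have d'0 : 0 < d' by rewrite lt_min d0 invr_gt0 ltr0n.
have d'h : d' <= 2^-1 by rewrite ge_min lexx orbT.
have sd' : 0 < sin (pi * d').
  by apply: sin_gt0_pi; rewrite mulr_gt0//= gtr_pMr//; lra.
exists (sin (pi * d') ^+ 2); first by rewrite exprn_gt0.
move=> t; have [k [kle ->]] := nearest_int t => H; exists k.
rewrite (@lt_le_trans _ _ d')//; last by rewrite ge_min lexx.
rewrite ltNge; apply: contraL H => dk; rewrite -leNgt.
rewrite ler_sqr ?nnegrE ?(ltW sd')//; last first.
  apply: sin_ge0_pi; rewrite mulr_ge0 ?(ltW pi0)//= ger_pMr//; lra.
have I u : 0 <= u <= 2^-1 -> pi * u \in `[(- (pi / 2)), (pi / 2) : R].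
  move=> /andP[u0 u1]; rewrite in_itv/=.
  have := mulr_ge0 (ltW pi0) u0; have := ler_wpM2l (ltW pi0) u1; lra.
by rewrite leNgt ltr_sin ?ltr_pM2l -?leNgt ?I ?normr_ge0 ?(ltW d'0).
Qed.

Lemma sin_2piM_period (j : nat) (u v : R) : `|u - v| = 1 ->
  sin (2 * pi * j%:R * u) = sin (2 * pi * j%:R * v).
Proof.
have H (w : R) : sin (2 * pi * j%:R * (w + 1)) = sin (2 * pi * j%:R * w).
  rewrite mulrDr mulr1 (_ : 2 * pi * j%:R = (pi *+ 2) *+ j); last first.
    by rewrite -(mulr_natr (pi *+ 2)) -(mulr_natr pi 2) (mulrC pi).
  by rewrite (periodicn (@sinD2pi R)).
case: (ger0P (u - v)) => _ uv1.
  by rewrite -(subrK v u) uv1 addrC H.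
by rewrite -(subrK u v) -opprB uv1 addrC H.
Qed.

Lemma derive_bounded_lipschitz (f df : R -> R) (a b : R) :
  (forall x, is_derive x (1 : R) f (df x)) -> (forall x, `|df x| <= 1) ->
  `|f a - f b| <= `|a - b|.
Proof.
move=> fd df1; wlog ab : a b / a <= b.
  move=> H; have [/H//|ba] := leP a b.
  by rewrite distrC (distrC a); apply: H; exact: ltW.
have [|c _ E] := @MVT_segment R f df a b ab (fun x _ => fd x).
  apply: continuous_subspaceT => x.
  by apply: differentiable_continuous; apply/derivable1_diffP; have [] := fd x.
by rewrite distrC E normrM (distrC a) ler_piMl.
Qed.

Lemma measurable_sinR : measurable_fun setT (@sin R).
Proof. by apply: continuous_measurable_fun; exact: continuous_sin. Qed.

Lemma normc_ge0 (z : R[i]) : 0 <= Normc.normc z.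
Proof. by case: z => a b; exact: sqrtr_ge0. Qed.

Lemma normc_le_ReIm (z : R[i]) :
  Normc.normc z <= `|complex.Re z| + `|complex.Im z|.
Proof.
case: z => a b; rewrite /Normc.normc /=.
rewrite -[leRHS]ger0_norm ?addr_ge0// -sqrtr_sqr ler_wsqrtr//.
rewrite sqrrD !real_normK ?num_real//.
have := mulr_ge0 (normr_ge0 a) (normr_ge0 b); lra.
Qed.

Lemma ReIm_le_normc (z : R[i]) :
  `|complex.Re z| <= Normc.normc z /\ `|complex.Im z| <= Normc.normc z.
Proof.
case: z => a b; rewrite /Normc.normc /= -!sqrtr_sqr !ler_wsqrtr//.
  by rewrite lerDr sqr_ge0.
by rewrite lerDl sqr_ge0.
Qed.

Lemma normc_expi (t : R) : Normc.normc (expi t) = 1.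
Proof. by rewrite /expi /Normc.normc cos2Dsin2 sqrtr1. Qed.

Lemma expiN (t : R) : expi t * expi (- t) = 1.
Proof.
apply/eqP; rewrite /expi cosN sinN eq_complex /=.
apply/andP; split; apply/eqP; last by ring.
by rewrite -(cos2Dsin2 t); ring.
Qed.

Lemma expi_lipschitz (a b : R) :
  Normc.normc (expi a - expi b) <= 2 * `|a - b|.
Proof.
apply: (le_trans (normc_le_ReIm _)); rewrite /expi /= mulr_natl mulr2n.
apply: lerD.
  apply: (@derive_bounded_lipschitz (@cos R) (fun x => - sin x)) => x.
  by rewrite normrN; exact: sin_max.
by apply: (@derive_bounded_lipschitz (@sin R) (@cos R)) => x; exact: cos_max.
Qed.

End trigonometry.

(** * The Fejer kernel of the circle *)

Lemma sum_symmetric (V : zmodType) (a : int -> V) N :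
  \sum_(k < (2 * N).+1) a (k%:Z - N%:Z) =
  a 0 + \sum_(j < N) (a j.+1%:Z + a (- j.+1%:Z)).
Proof.
elim: N => [|N IH].
  by rewrite muln0 big_ord_recl !big_ord0 !addr0.
rewrite (_ : 2 * N.+1 = (2 * N).+2)%N; last by rewrite mulnS.
rewrite big_ord_recl big_ord_recr /= [in RHS]big_ord_recr /= [RHS]addrA -IH.
have -> : (bump 0 (2 * N).+1)%:Z - N.+1%:Z = N.+1%:Z by rewrite /bump /=; lia.
rewrite (_ : 0%Z - N.+1%:Z = - N.+1%:Z); last by lia.
rewrite [LHS]addrC [RHS]addrA; congr (_ + _); congr (_ + _).
by apply: eq_bigr => i _; congr (a _); rewrite /bump /=; lia.
Qed.

Section fejer_kernel.
Variable R : realType.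
Implicit Types (N : nat) (t x : R).

(** The real form of [fejer1], with the frequencies j and -j grouped together. *)
Definition fejerR N t : R :=
  1 + \sum_(j < N) 2 * (1 - j.+1%:R / N.+1%:R) * cos (2 * pi * j.+1%:R * t).

Lemma fejer1E N t : fejer1 N t = (fejerR N t)%:C%C.
Proof.
rewrite /fejer1 /=.
rewrite (sum_symmetric (fun m : int => (1 - `|m|%:~R / N.+1%:R)%:C%C *
  expi (2 * pi * m%:~R * t))).
rewrite /fejerR [RHS](rmorphD (real_complex R)) (rmorph_sum (real_complex R)) /=.
congr (_ + _).
  rewrite normr0 mul0r subr0 mulr0 mul0r /expi cos0 sin0.
  by rewrite mul1r.
apply: eq_bigr => i _.
rewrite normrN -mulrDr.
apply/eqP; rewrite eq_complex /expi rmorphN /= -!pmulrn mulrN mulNr cosN sinN.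
rewrite !subrr !(mulr0,mul0r,subr0,addr0) eqxx andbT; apply/eqP; ring.
Qed.

(** The increments of the Fejer kernels multiplied by N+1 are Dirichlet kernels;
    both closed forms below follow from this recursion. *)
Lemma fejerRS N t : N.+2%:R * fejerR N.+1 t = N.+1%:R * fejerR N t +
  (1 + \sum_(j < N.+1) 2 * cos (2 * pi * j.+1%:R * t)).
Proof.
have E M : M.+1%:R * fejerR M t = M.+1%:R +
    \sum_(j < M) 2 * (M.+1%:R - j.+1%:R) * cos (2 * pi * j.+1%:R * t).
  rewrite /fejerR mulrDr mulr1 mulr_sumr; congr (_ + _).
  by apply: eq_bigr => i _; field.
rewrite !E.
transitivity (N.+2%:R + \sum_(j < N.+1)
    (2 * (N.+1%:R - j.+1%:R) * cos (2 * pi * j.+1%:R * t) +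
     2 * cos (2 * pi * j.+1%:R * t))).
  congr (_ + _); apply: eq_bigr => i _.
  by rewrite -(natr1 N.+1); ring.
rewrite big_split /=.
rewrite [X in _ + (X + _) = _]big_ord_recr /= subrr mulr0 mul0r addr0.
by rewrite -(natr1 N.+1); ring.
Qed.

(** (N+1) F_N is the squared modulus of the sum of the e^{2 pi i j t} for
    0 <= j <= N, which is why the Fejer kernel is nonnegative. *)
Lemma fejerR_sqr N t : N.+1%:R * fejerR N t =
  (\sum_(j < N.+1) cos (2 * pi * j%:R * t)) ^+ 2 +
  (\sum_(j < N.+1) sin (2 * pi * j%:R * t)) ^+ 2.
Proof.
elim: N => [|N IH].
  rewrite /fejerR big_ord0 !big_ord_recl !big_ord0 /= !(mulr0,mul0r) cos0 sin0; ring.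
rewrite fejerRS IH [in RHS]big_ord_recr /= [in X in _ = _ + X]big_ord_recr /=.
set C := \sum_(j < N.+1) cos _; set S := \sum_(j < N.+1) sin _.
set c := cos (2 * pi * N.+1%:R * t); set s := sin (2 * pi * N.+1%:R * t).
have -> : \sum_(j < N.+1) 2 * cos (2 * pi * j.+1%:R * t) = 2 * (C * c + S * s).
  rewrite (reindex_inj rev_ord_inj) /= -mulr_sumr; congr (_ * _).
  rewrite /C /S !mulr_suml -big_split /=; apply: eq_bigr => i _.
  transitivity (cos (2 * pi * N.+1%:R * t - 2 * pi * i%:R * t)); last first.
    by rewrite cosB -/c -/s; ring.
  congr cos.
  have iN : (i <= N)%N by rewrite -ltnS ltn_ord.
  by rewrite subSS -subSn // natrB ?(leqW iN)//; ring.
have : c ^+ 2 + s ^+ 2 = 1 by exact: cos2Dsin2.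
move=> H; transitivity (C ^+ 2 + S ^+ 2 + (c ^+ 2 + s ^+ 2 + 2 * (C * c + S * s))).
  by rewrite H.
ring.
Qed.

Lemma fejerR_ge0 N t : 0 <= fejerR N t.
Proof.
by rewrite -(pmulr_rge0 _ (ltr0Sn R N)) fejerR_sqr addr_ge0// sqr_ge0.
Qed.

Lemma dirichlet_sin M t :
  sin (pi * t) * (1 + \sum_(j < M) 2 * cos (2 * pi * j.+1%:R * t)) =
  sin (pi * (2 * M).+1%:R * t).
Proof.
elim: M => [|M IH]; first by rewrite big_ord0 addr0 muln0 !mulr1.
rewrite big_ord_recr /= addrA mulrDr IH.
set A := 2 * pi * M.+1%:R * t; set B := pi * t.
have -> : pi * (2 * M).+1%:R * t = A - B.
  by rewrite /A /B -(natr1 (2 * M)) natrM -(natr1 M); ring.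
have -> : pi * (2 * M.+1).+1%:R * t = A + B.
  by rewrite /A /B -(natr1 (2 * M.+1)) natrM -(natr1 M); ring.
by rewrite sinB sinD; ring.
Qed.

Lemma fejerR_sin N t :
  N.+1%:R * fejerR N t * sin (pi * t) ^+ 2 = sin (pi * N.+1%:R * t) ^+ 2.
Proof.
elim: N => [|N IH]; first by rewrite /fejerR big_ord0 addr0 !(mulr1,mul1r).
rewrite fejerRS mulrDl IH expr2 mulrA [X in _ + X * _]mulrC dirichlet_sin.
set A := pi * N.+2%:R * t; set B := pi * N.+1%:R * t.
have -> : pi * (2 * N.+1).+1%:R * t = A + B.
  by rewrite /A /B -(natr1 (2 * N.+1)) natrM -(natr1 N.+1) -(natr1 N); ring.
have -> : pi * t = A - B.
  by rewrite /A /B -(natr1 N.+1) -(natr1 N); ring.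
rewrite sinB sinD.
have /eqP := cos2Dsin2 A; rewrite eq_sym -subr_eq => /eqP HA.
have /eqP := cos2Dsin2 B; rewrite eq_sym -subr_eq => /eqP HB.
transitivity (sin B ^+ 2 + (sin A ^+ 2 * cos B ^+ 2 - cos A ^+ 2 * sin B ^+ 2)).
  by ring.
by rewrite -HA -HB; ring.
Qed.

(** This inequality is what concentrates the kernel near the integers. *)
Lemma fejerR_tail N t : sin (pi * t) ^+ 2 * fejerR N t <= N.+1%:R^-1.
Proof.
rewrite -[leRHS]mul1r ler_pdivlMr ?ltr0Sn//.
rewrite [leLHS](_ : _ = N.+1%:R * fejerR N t * sin (pi * t) ^+ 2); last by ring.
rewrite fejerR_sin.
by rewrite -real_normK ?num_real// expr_le1// sin_max.
Qed.

Lemma fejerR_le N (t : R) : fejerR N t <= 1 + 2 * N%:R.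
Proof.
rewrite lerD2l mulr_natr -[in leRHS](card_ord N) -sumr_const; apply: ler_sum => j _.
have c1 := cos_le1 (2 * pi * j.+1%:R * t).
rewrite -mulrA ler_piMr//.
have j0 : 0 <= 1 - j.+1%:R / N.+1%:R :> R.
  by rewrite subr_ge0 ler_pdivrMr// mul1r ler_nat ltnS ltnW.
apply: (@le_trans _ _ ((1 - j.+1%:R / N.+1%:R) * 1)); first exact: ler_wpM2l.
by rewrite mulr1 gerBl divr_ge0.
Qed.

Lemma fejerR_even N t : fejerR N (- t) = fejerR N t.
Proof.
by congr (_ + _); apply: eq_bigr => j _; rewrite mulrN cosN.
Qed.

Lemma continuous_fejerR N : continuous (fejerR N).
Proof.
suff H M (a : nat -> R) :
    continuous (fun t => \sum_(j < M) a j * cos (2 * pi * j.+1%:R * t)).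
  move=> t; apply: cvgD; first exact: cvg_cst.
  exact: (H N (fun j => 2 * (1 - j.+1%:R / N.+1%:R))).
elim: M => [|M IH] t.
  by under eq_fun do rewrite big_ord0; exact: cvg_cst.
under eq_fun do rewrite big_ord_recr /=.
apply: cvgD; first exact: IH.
apply: cvgM; first exact: cvg_cst.
apply: continuous_cvg; first exact: continuous_cos.
by apply: cvgM; [exact: cvg_cst|exact: cvg_id].
Qed.

Lemma measurable_fejerR N : measurable_fun setT (fejerR N).
Proof.
by apply: continuous_measurable_fun; exact: continuous_fejerR.
Qed.

(** An interval of length |s| is a period of y |-> F_N ((x - y) / s), over which
    all terms but the constant one have integral 0. *)
Lemma integral_fejer_cell N x s : s != 0 ->
  (\int[lebesgue_measure]_(y in `[(- (`|s| / 2))%R, (`|s| / 2)%R])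
     (fejerR N ((x - y) * s^-1))%:E = `|s|%:E)%E.
Proof.
move=> s0; have as0 : 0 < `|s| by rewrite normr_gt0.
set b := `|s| / 2.
pose h (j : nat) : R := 2 * pi * j.+1%:R.
have h0 j : h j != 0 by rewrite /h mulf_neq0// ?mulf_neq0 ?pnatr_eq0// gt_eqF// pi_gt0.
pose w (j : nat) : R := 2 * (1 - j.+1%:R / N.+1%:R).
(* A termwise antiderivative. *)
pose F (y : R) : R :=
  y + \sum_(j < N) (- (w j * s / h j)) * sin (h j * ((x - y) * s^-1)).
have dF (y : R) : is_derive y (1 : R) F (fejerR N ((x - y) * s^-1)).
  rewrite /F /fejerR.
  apply: is_deriveD.
  rewrite -[X in is_derive _ _ X _](@fct_sumE _ R R _ xpredT).
  apply: is_derive_sum => j.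
  have dl : is_derive y (1 : R) (fun y => h j * ((x - y) * s^-1)) (h j * - s^-1).
    apply: is_derive_eq.
    rewrite /= /GRing.scale/=; ring.
  have dsin := @is_derive1_comp R (@sin R) _ y _ _ (is_derive_sin _) dl.
  apply: is_derive_eq.
  rewrite /= /GRing.scale/= /w; field.
  by rewrite s0 h0 addrC natr1 pnatr_eq0.
rewrite (@continuous_FTC2 _ _ F).
- rewrite -EFinB; congr EFin; rewrite /F opprD addrACA -sumrB big1 ?addr0.
    by rewrite /b; lra.
  move=> j _; rewrite -mulrBr.
  rewrite (@sin_2piM_period R j.+1 _ ((x - - b) * s^-1)) ?subrr ?mulr0//.
  rewrite -mulrBl (_ : x - b - _ = - `|s|); last by rewrite /b; lra.
  by rewrite normrM normrN normr_id normfV divff ?normr_eq0.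
- by rewrite /b; lra.
- apply: continuous_subspaceT => y.
  apply: (@continuous_comp _ _ _ (fun y => (x - y) * s^-1) (fejerR N));
    last exact: continuous_fejerR.
  apply: cvgM; last exact: cvg_cst.
  by apply: cvgB; [exact: cvg_cst|exact: cvg_id].
- have cF (y : R) : {for y, continuous F}.
    by apply: differentiable_continuous; apply/derivable1_diffP; have [] := dF y.
  split=> [y _|//|//].
  + by have [] := dF y.
  + by apply: cvg_at_right_filter; exact: cF.
  + by apply: cvg_at_left_filter; exact: cF.
- by move=> y _; rewrite derive1E; have [_ ->] := dF y.
Qed.

End fejer_kernel.
Arguments measurable_fejerR {R} N.

(** * Integration preliminaries *)

(** The integral of a nonnegative function is a supremum over simple functions
    below it, so monotonicity holds without measurability. *)
Lemma ge0_le_integralT d (T : measurableType d) (R : realType)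
    (mu : {measure set T -> \bar R}) (f g : T -> \bar R) :
  (forall x, 0 <= f x)%E -> (forall x, f x <= g x)%E ->
  (\int[mu]_x f x <= \int[mu]_x g x)%E.
Proof.
move=> f0 fg; have g0 x : (0 <= g x)%E by exact: le_trans (fg x).
rewrite !ge0_integralTE//; apply: le_ereal_sup => _ /= [h hf <-].
by exists h => // x; exact: le_trans (fg x).
Qed.

Lemma ge0_le_integral_on d (T : measurableType d) (R : realType)
    (m : {measure set T -> \bar R}) (D : set T) (f g : T -> \bar R) :
  (forall x, D x -> 0 <= f x)%E -> (forall x, D x -> f x <= g x)%E ->
  (\int[m]_(x in D) f x <= \int[m]_(x in D) g x)%E.
Proof.
move=> f0 fg; rewrite !(integral_mkcond D); apply: ge0_le_integralT => x;
  rewrite !patchE; case: ifPn; rewrite ?inE// => Dx; [exact: f0|exact: fg].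
Qed.

(** The graph of a |-> a^p lies above its tangent at m.  This is Young's inequality
    for a and m^(p-1), multiplied by p. *)
Lemma powR_tangent (R : realType) (p a m : R) : 1 <= p -> 0 <= a -> 0 <= m ->
  p * m `^ (p - 1) * a <= a `^ p + (p - 1) * m `^ p.
Proof.
move=> p1 a0 m0; have p0 : 0 < p by exact: lt_le_trans p1.
move: p1; rewrite le_eqVlt => /predU1P[<-|p1].
  by rewrite subrr powRr0 !mul1r powRr1// mul0r addr0.
have p10 : 0 < p - 1 by rewrite subr_gt0.
pose q := p / (p - 1).
have q0 : 0 < q by rewrite divr_gt0.
have pq : p^-1 + q^-1 = 1.
  by rewrite /q invf_div; field; rewrite gt_eqF.
have := @conjugate_powR R a (m `^ (p - 1)) p q a0 (powR_ge0 _ _) p0 q0 pq.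
rewrite -powRrM (_ : (p - 1) * q = p); last by rewrite /q; field; rewrite gt_eqF.
rewrite -(ler_pM2l p0); set A := m `^ (p - 1); set B := a `^ p; set C := m `^ p.
rewrite (_ : p * (a * A) = p * A * a); last by ring.
rewrite (_ : p * (B / p + C / q) = B + (p - 1) * C)//.
by rewrite /q; field; rewrite !gt_eqF.
Qed.

Lemma le_powR_add (R : realType) (p a : R) : 1 <= p -> 0 <= a ->
  a <= a `^ p + p.
Proof.
move=> p1 a0; have := powR_tangent p1 a0 ler01.
rewrite !powR1 !mulr1 => H; apply: (@le_trans _ _ (p * a)); first by rewrite ler_peMl.
by apply: (le_trans H); rewrite lerD2l lerBlDr lerDl ler01.
Qed.

Lemma powR_add_le (R : realType) (p a b : R) : 0 <= p -> 0 <= a -> 0 <= b ->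
  (a + b) `^ p <= 2 `^ p * (a `^ p + b `^ p).
Proof.
move=> p0; wlog ab : a b / a <= b.
  move=> H a0 b0; case/orP: (le_total a b) => ab; first exact: H.
  by rewrite addrC [X in _ * X]addrC; exact: H.
move=> a0 b0; apply: (@le_trans _ _ ((2 * b) `^ p)).
  by rewrite ge0_ler_powR// ?nnegrE ?addr_ge0 ?mulr_ge0// mulr_natl mulr2n lerD.
by rewrite powRM// ler_wpM2l ?powR_ge0// lerDr powR_ge0.
Qed.

Lemma ge0_cvge0P (R : realType) (u : nat -> \bar R) : (forall N, 0 <= u N)%E ->
  u @ \oo --> 0%E <-> (forall e : R, 0 < e -> \forall N \near \oo, (u N <= e%:E)%E).
Proof.
move=> u0; split.
  move=> /fine_cvgP[fu /cvgrPdist_le cu] e e0; near=> N.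
  have fN : u N \is a fin_num by near: N.
  rewrite -(fineK fN) lee_fin -[leLHS]ger0_norm ?fine_ge0//.
  by rewrite -normrN -[- _]sub0r; near: N; exact: cu.
move=> H; apply/fine_cvgP; split.
  have := H 1 ltr01; apply: filterS => N uN.
  by rewrite ge0_fin_numE// (le_lt_trans uN)// ltey.
apply/cvgrPdist_le => e e0; have := H e e0; apply: filterS => N uN.
rewrite sub0r normrN ger0_norm/= ?fine_ge0// -lee_fin fineK//.
by rewrite ge0_fin_numE// (le_lt_trans uN)// ltey.
Unshelve. all: by end_near. Qed.

Lemma poweR_Lnorm_on d (T : measurableType d) (R : realType)
    (m : {measure set T -> \bar R}) (p : R) (D : set T) (h : T -> R[i]) : 0 < p ->
  (Lnorm_on m p%:E D h `^ p = \int[m]_(x in D) (Normc.normc (h x) `^ p)%:E)%E.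
Proof.
move=> p0; rewrite /Lnorm_on poweR_Lnorm ?gt_eqF// [RHS]integral_mkcond.
apply: eq_integral => x _; rewrite !patchE; case: ifPn => _ /=.
  by rewrite ger0_norm// normc_ge0.
by rewrite normr0 powR0// gt_eqF.
Qed.

Section finite_restriction.
Context d (T : measurableType d) (R : realType) (mu : {measure set T -> \bar R}).
Context (D : set T) (mD : measurable D) (muD : (mu D < +oo)%E).

Let integral_mfrestr_in (f : T -> \bar R) :
  (\int[mfrestr mD muD]_(x in D) f x = \int[mu]_(x in D) f x)%E.
Proof.
apply: eq_measure_integral => A mA AD.
by rewrite /= /mfrestr /mrestr setIidl.
Qed.

Lemma integral_mfrestr (f : T -> \bar R) : measurable_fun setT f ->
  (\int[mfrestr mD muD]_x f x = \int[mu]_(x in D) f x)%E.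
Proof.
have nn (g : T -> \bar R) : (forall x, 0 <= g x)%E -> measurable_fun setT g ->
    (\int[mfrestr mD muD]_x g x = \int[mfrestr mD muD]_(x in D) g x)%E.
  move=> g0 mg; rewrite (@ge0_negligible_integral _ _ _ _ setT (~` D))//.
  - by rewrite setTD setCK.
  - exact: measurableC.
  - by rewrite /= /mfrestr /mrestr setICl measure0.
move=> mf; rewrite -[RHS]integral_mfrestr_in [LHS]integralE [RHS]integralE.
by rewrite !nn//; [exact: measurable_funeneg|exact: measurable_funepos].
Qed.

End finite_restriction.

(** * Means against a symmetric probability kernel *)

Section mean_oscillation.
Context d (T : measurableType d) (R : realType).
Context (mu : {finite_measure set T -> \bar R}) (k : nat -> T -> T -> R) (p : R).
Hypothesis p_ge1 : 1 <= p.
Hypothesis k_ge0 : forall N x y, 0 <= k N x y.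
Hypothesis k_measurable :
  forall N, measurable_fun [set: T * T] (fun z => k N z.1 z.2).
Hypothesis k_sym : forall N x y, k N x y = k N y x.
Hypothesis k_mass : forall N x, (\int[mu]_y (k N x y)%:E = 1)%E.

Let p_gt0 : 0 < p. Proof. exact: lt_le_trans p_ge1. Qed.

Let p_ge0 : 0 <= p. Proof. exact: ltW. Qed.

(** The mean oscillation of [h] at the scale of the kernel [k N]. *)
Definition osc (h : T -> R) N : \bar R :=
  (\int[mu]_x \int[mu]_y (`|h x - h y| `^ p * k N x y)%:E)%E.

Lemma measurable_kernel N x : measurable_fun [set: T] (k N x).
Proof.
rewrite (_ : k N x = (fun z => k N z.1 z.2) \o pair x)//.
by apply: measurableT_comp => //; exact: measurable_pair1.
Qed.

Lemma measurable_powR_norm (h : T -> R) : measurable_fun setT h ->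
  measurable_fun setT (fun x => `|h x| `^ p).
Proof.
move=> mh; apply: (measurableT_comp (measurable_powR p)).
exact: measurableT_comp.
Qed.

Lemma integrable_powR (u : T -> R) : measurable_fun setT u ->
  (\int[mu]_x (`|u x| `^ p)%:E < +oo)%E -> mu.-integrable setT (EFin \o u).
Proof.
move=> m_u up; have mup := measurable_powR_norm m_u.
apply: (@le_integrable _ _ _ mu setT measurableT _
  (EFin \o (fun x => `|u x| `^ p + p))).
- exact/measurable_EFinP.
- move=> x _; rewrite /= lee_fin [leRHS]ger0_norm ?addr_ge0 ?powR_ge0//.
  exact: le_powR_add.
- apply/integrableP; split.
    by apply/measurable_EFinP; exact: measurable_funD.
  under eq_integral => x _ do rewrite /= ger0_norm ?addr_ge0 ?powR_ge0// EFinD.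
  rewrite ge0_integralD//.
  + rewrite integral_cst// lte_add_pinfty// lte_mul_pinfty// ?lee_fin//.
    by rewrite ltey_eq fin_num_measure.
  + exact/measurable_EFinP.
Qed.

(** Jensen's inequality for the probability k N x y dy: with m the mean of
    |h x - h y|, integrate the tangent inequality of a^p at m.  When the right-hand
    side is infinite there is nothing to prove; otherwise its finiteness provides
    the integrability of h against the kernel. *)
Lemma powR_jensen (h : T -> R) N x : measurable_fun setT h ->
  ((`|\int[mu]_y (h y * k N x y) - h x| `^ p)%:E <=
   \int[mu]_y (`|h x - h y| `^ p * k N x y)%:E)%E.
Proof.
move=> mh; have mk := measurable_kernel N x.
pose a (y : T) : R := `|h x - h y|; have a0 y : 0 <= a y by exact: normr_ge0.
have mhx : measurable_fun setT (fun y => h x - h y) by exact: measurable_funB.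
have ma : measurable_fun setT a by exact: measurableT_comp.
have mak : measurable_fun setT (fun y => a y * k N x y) by exact: measurable_funM.
have mapk : measurable_fun setT (fun y => a y `^ p * k N x y).
  by apply: measurable_funM => //; exact: measurable_powR_norm.
have [->|Afin] := eqVneq (\int[mu]_y (a y `^ p * k N x y)%:E)%E +oo%E.
  by rewrite leey.
have iap : mu.-integrable setT (EFin \o (fun y => a y `^ p * k N x y)).
  apply/integrableP; split; first exact/measurable_EFinP.
  under eq_integral => y _ do rewrite /= ger0_norm ?mulr_ge0 ?powR_ge0//.
  by rewrite ltey.
have ik : mu.-integrable setT (EFin \o k N x).
  apply/integrableP; split; first exact/measurable_EFinP.
  under eq_integral => y _ do rewrite /= ger0_norm//.
  by rewrite k_mass ltey.
have ia : mu.-integrable setT (EFin \o (fun y => a y * k N x y)).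
  apply: (@le_integrable _ _ _ mu setT measurableT _
    (EFin \o (fun y => a y `^ p * k N x y + p * k N x y))).
  - exact/measurable_EFinP.
  - move=> y _; rewrite /= lee_fin !ger0_norm ?addr_ge0 ?mulr_ge0 ?powR_ge0//.
    by rewrite -mulrDl ler_wpM2r// le_powR_add.
  - apply: (@integrableD _ _ _ mu setT measurableT
      (EFin \o (fun y => a y `^ p * k N x y)) (EFin \o (fun y => p * k N x y))) => //.
    exact: (@integrableZl _ _ _ mu setT measurableT p (EFin \o k N x)).
have ihx : mu.-integrable setT (EFin \o (fun y => h x * k N x y)).
  exact: (@integrableZl _ _ _ mu setT measurableT (h x) (EFin \o k N x)).
have id : mu.-integrable setT (EFin \o (fun y => (h y - h x) * k N x y)).
  apply: (le_integrable measurableT _ _ ia).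
  - apply/measurable_EFinP; apply: measurable_funM => //; exact: measurable_funB.
  - by move=> y _; rewrite /= lee_fin !normrM normr_id distrC.
have -> : \int[mu]_y (h y * k N x y) - h x = \int[mu]_y ((h y - h x) * k N x y).
  have -> : \int[mu]_y (h y * k N x y) =
      \int[mu]_y ((h y - h x) * k N x y + h x * k N x y).
    by apply: eq_Rintegral => y _; ring.
  rewrite RintegralD// RintegralZl// [X in _ * X](_ : _ = 1) ?mulr1 ?addrK//.
  by rewrite /Rintegral k_mass.
set m := \int[mu]_y (a y * k N x y).
have m0 : 0 <= m by apply: Rintegral_ge0 => y _; rewrite mulr_ge0.
have lem : `|\int[mu]_y ((h y - h x) * k N x y)| <= m.
  apply: (le_trans (le_normr_Rintegral measurableT id)).
  rewrite le_eqVlt; apply/orP; left; apply/eqP/eq_Rintegral => y _.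
  by rewrite normrM (ger0_norm (k_ge0 _ _ _)) distrC.
have iA : (\int[mu]_y (a y `^ p * k N x y)%:E)%E \is a fin_num.
  exact: integrable_fin_num iap.
rewrite -(fineK iA) lee_fin (le_trans (ge0_ler_powR p_ge0 _ _ lem))//.
set A := fine _.
have : \int[mu]_y (p * m `^ (p - 1) * (a y * k N x y)) <=
    \int[mu]_y (a y `^ p * k N x y + (p - 1) * m `^ p * k N x y).
  apply: le_Rintegral => //.
  - exact: (@integrableZl _ _ _ mu setT measurableT _
      (EFin \o (fun y => a y * k N x y))).
  - apply: (@integrableD _ _ _ mu setT measurableT
      (EFin \o (fun y => a y `^ p * k N x y))
      (EFin \o (fun y => (p - 1) * m `^ p * k N x y))) => //.
    exact: (@integrableZl _ _ _ mu setT measurableT _ (EFin \o k N x)).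
  - by move=> y _; rewrite mulrA -mulrDl ler_wpM2r//; exact: powR_tangent.
rewrite RintegralZl// RintegralD// ?RintegralZl//; last first.
  exact: (@integrableZl _ _ _ mu setT measurableT _ (EFin \o k N x)).
rewrite [X in _ * X <= _ -> _](_ : _ = m)// [X in _ + _ * X](_ : _ = 1); last first.
  by rewrite /Rintegral k_mass.
have -> : \int[mu]_y (a y `^ p * k N x y) = A by [].
rewrite -mulrA (mulrC _ m) mulr_powRB1//.
lra.
Qed.

Definition osc_integrand (h : T -> R) N (z : T * T) : R :=
  `|h z.1 - h z.2| `^ p * k N z.1 z.2.

Lemma osc_integrand_ge0 h N z : 0 <= osc_integrand h N z.
Proof. by rewrite mulr_ge0// powR_ge0. Qed.

Lemma measurable_fst_snd (h : T -> R) : measurable_fun setT h ->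
  measurable_fun [set: T * T] (fun z => h z.1) /\
  measurable_fun [set: T * T] (fun z => h z.2).
Proof.
by move=> mh; split; apply: (measurableT_comp mh);
  [exact: measurable_fst|exact: measurable_snd].
Qed.

Lemma measurable_osc_integrand h N : measurable_fun setT h ->
  measurable_fun setT (EFin \o osc_integrand h N).
Proof.
move=> /measurable_fst_snd[m1 m2]; apply/measurable_EFinP.
apply: measurable_funM => //; apply: (measurableT_comp (measurable_powR p)).
by apply: measurableT_comp => //; exact: measurable_funB.
Qed.

Lemma oscE h N : measurable_fun setT h ->
  osc h N = (\int[mu \x mu]_z (osc_integrand h N z)%:E)%E.
Proof.
move=> mh; rewrite (fubini_tonelli1 (EFin \o osc_integrand h N))//.
- exact: measurable_osc_integrand.
- by move=> z; rewrite lee_fin osc_integrand_ge0.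
Qed.

Lemma osc_ge0 h N : (0 <= osc h N)%E.
Proof.
apply: integral_ge0 => x _; apply: integral_ge0 => y _.
by rewrite lee_fin mulr_ge0// powR_ge0.
Qed.

Lemma osc_le_add (f g h : T -> R) N :
  measurable_fun setT f -> measurable_fun setT g -> measurable_fun setT h ->
  (forall x y, `|h x - h y| <= `|f x - f y| + `|g x - g y|) ->
  (osc h N <= (2 `^ p)%:E * (osc f N + osc g N))%E.
Proof.
move=> mf mg mh hfg; rewrite !oscE//.
rewrite -ge0_integralD//; last 4 first.
- by move=> z _; rewrite lee_fin osc_integrand_ge0.
- exact: measurable_osc_integrand.
- by move=> z _; rewrite lee_fin osc_integrand_ge0.
- exact: measurable_osc_integrand.
rewrite -ge0_integralZl//; last 2 first.
- exact: (emeasurable_funD (measurable_osc_integrand N mf)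
    (measurable_osc_integrand N mg)).
- by move=> z _; rewrite adde_ge0// lee_fin osc_integrand_ge0.
apply: ge0_le_integralT => z; first by rewrite lee_fin osc_integrand_ge0.
rewrite -EFinD -EFinM lee_fin /osc_integrand -mulrDl mulrA ler_wpM2r//.
apply: le_trans (powR_add_le p_ge0 (normr_ge0 _) (normr_ge0 _)).
by rewrite ge0_ler_powR// nnegrE addr_ge0.
Qed.

(** Unit mass in the second variable handles |h x|^p; by symmetry of the kernel
    the same holds for |h y|^p.  This makes vanishing of the oscillation stable under
    approximation in L^p, uniformly in N. *)
Lemma osc_le_norm (h : T -> R) N : measurable_fun setT h ->
  (osc h N <= (2 `^ p)%:E *
    (\int[mu]_x (`|h x| `^ p)%:E + \int[mu]_x (`|h x| `^ p)%:E))%E.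
Proof.
move=> mh; have mhp := measurable_powR_norm mh.
have [m1 m2] := measurable_fst_snd mhp.
pose u1 z := (`|h z.1| `^ p * k N z.1 z.2)%:E.
pose u2 z := (`|h z.2| `^ p * k N z.1 z.2)%:E.
have u1_ge0 z : (0 <= u1 z)%E by rewrite lee_fin mulr_ge0// powR_ge0.
have u2_ge0 z : (0 <= u2 z)%E by rewrite lee_fin mulr_ge0// powR_ge0.
have mu1 : measurable_fun setT u1 by apply/measurable_EFinP; exact: measurable_funM.
have mu2 : measurable_fun setT u2 by apply/measurable_EFinP; exact: measurable_funM.
have E x : (\int[mu]_y (`|h x| `^ p * k N x y)%:E = (`|h x| `^ p)%:E)%E.
  under eq_integral => y _ do rewrite EFinM.
  rewrite ge0_integralZl// ?k_mass ?mule1//.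
  - by apply/measurable_EFinP; exact: measurable_kernel.
  - by move=> y _; rewrite lee_fin.
have I1 : (\int[mu \x mu]_z u1 z = \int[mu]_x (`|h x| `^ p)%:E)%E.
  rewrite fubini_tonelli1//; apply: eq_integral => x _; exact: E.
have I2 : (\int[mu \x mu]_z u2 z = \int[mu]_x (`|h x| `^ p)%:E)%E.
  rewrite fubini_tonelli2//; apply: eq_integral => y _.
  by rewrite /fubini_G /u2 /= -E; apply: eq_integral => x _; rewrite k_sym.
rewrite -[X in (X + _)%E]I1 -I2 oscE// -ge0_integralD// -ge0_integralZl//; last 2 first.
- exact: emeasurable_funD.
- by move=> z _; rewrite adde_ge0.
apply: ge0_le_integralT => z; first by rewrite lee_fin osc_integrand_ge0.
rewrite -EFinD -EFinM lee_fin /osc_integrand -mulrDl mulrA ler_wpM2r//.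
apply: le_trans (powR_add_le p_ge0 (normr_ge0 _) (normr_ge0 _)).
by rewrite ge0_ler_powR// ?nnegrE ?addr_ge0// ler_normB.
Qed.

Definition vanishing_osc (h : T -> R) : Prop := osc h N @[N --> \oo] --> 0%E.

Lemma vanishing_oscP h : vanishing_osc h <->
  (forall e : R, 0 < e -> \forall N \near \oo, (osc h N <= e%:E)%E).
Proof. by apply: ge0_cvge0P => N; exact: osc_ge0. Qed.

(** Stated with increments, so that it covers sums of functions as well as
    indicators of unions. *)
Lemma vanishing_osc_add (f g h : T -> R) :
  measurable_fun setT f -> measurable_fun setT g -> measurable_fun setT h ->
  (forall x y, `|h x - h y| <= `|f x - f y| + `|g x - g y|) ->
  vanishing_osc f -> vanishing_osc g -> vanishing_osc h.
Proof.
move=> mf mg mh hfg /vanishing_oscP vf /vanishing_oscP vg.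
apply/vanishing_oscP => e e0; pose c := 2 `^ p : R.
have c0 : 0 < c by exact: powR_gt0.
have d0 : 0 < e / (c * 2) by rewrite divr_gt0// mulr_gt0.
apply: filterS2 (vf _ d0) (vg _ d0) => N hf hg.
apply: (le_trans (osc_le_add N mf mg mh hfg)).
apply: (@le_trans _ _ (c%:E * ((e / (c * 2))%:E + (e / (c * 2))%:E))%E).
  rewrite lee_pmul2l// ?lte_fin ?powR_gt0//.
  exact: (leeD hf hg).
rewrite -EFinD -EFinM lee_fin le_eqVlt; apply/orP; left; apply/eqP.
by field; rewrite gt_eqF.
Qed.

Lemma vanishing_osc_approx (h : T -> R) : measurable_fun setT h ->
  (forall e : R, 0 < e -> exists f : T -> R, [/\ measurable_fun setT f,
     vanishing_osc f & (\int[mu]_x (`|h x - f x| `^ p)%:E <= e%:E)%E]) ->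
  vanishing_osc h.
Proof.
move=> mh H; apply/vanishing_oscP => e e0; pose c := 2 `^ p : R.
have c0 : 0 < c by exact: powR_gt0.
(* Chosen so that c (r + c (r + r)) = e, the bound that the sum of the oscillation
   of f and of the error term yields. *)
pose r := e / (c * (1 + c * 2)).
have r0 : 0 < r by rewrite divr_gt0// mulr_gt0// addr_gt0// mulr_gt0.
have [f [mf /vanishing_oscP vf hf]] := H r r0.
have mhf : measurable_fun setT (fun x => h x - f x) by exact: measurable_funB.
apply: filterS (vf _ r0) => N fN; apply: (le_trans (osc_le_add N mf mhf mh _)).
  move=> x y; rewrite (_ : h x - h y = (f x - f y) + (h x - f x - (h y - f y))).
    exact: ler_normD.
  by ring.
apply: (@le_trans _ _ (c%:E * (r%:E + c%:E * (r%:E + r%:E)))%E).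
  rewrite lee_pmul2l// ?lte_fin ?powR_gt0//.
  apply: (leeD fN).
  apply: (le_trans (osc_le_norm N mhf)).
  by rewrite lee_pmul2l// ?lte_fin ?powR_gt0//; exact: (leeD hf hf).
rewrite -!(EFinD,EFinM) lee_fin le_eqVlt; apply/orP; left; apply/eqP.
rewrite /r; field; rewrite !gt_eqF// addr_gt0// mulr_gt0//.
Qed.

Lemma vanishing_osc_scale (c : R) h : measurable_fun setT h ->
  vanishing_osc h -> vanishing_osc (fun x => c * h x).
Proof.
move=> mh vh; have mch : measurable_fun setT (fun x => c * h x).
  exact: measurable_funM.
suff E N : osc (fun x => c * h x) N = ((`|c| `^ p)%:E * osc h N)%E.
  rewrite /vanishing_osc; under eq_fun do rewrite E.
  by rewrite -(mule0 (`|c| `^ p)%:E); apply: cvgeZl.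
rewrite !oscE// -ge0_integralZl//; last 2 first.
- exact: measurable_osc_integrand.
- by move=> z _; rewrite lee_fin osc_integrand_ge0.
apply: eq_integral => z _; rewrite -EFinM /osc_integrand mulrA -powRM//.
by rewrite -normrM mulrBr.
Qed.

Lemma vanishing_osc_dominated (h : T -> R) (f : nat -> T -> R) (g : T -> R) :
  measurable_fun setT h -> (forall m, measurable_fun setT (f m)) ->
  measurable_fun setT g ->
  (forall x, f m x @[m --> \oo] --> h x) ->
  (forall m x, `|f m x| <= g x) -> (forall x, `|h x| <= g x) ->
  (\int[mu]_x (`|g x| `^ p)%:E < +oo)%E ->
  (forall m, vanishing_osc (f m)) -> vanishing_osc h.
Proof.
move=> mh mf mg fh fg hg gp vf; apply: vanishing_osc_approx => // e e0.
have g0 x : 0 <= g x by exact: le_trans (hg x).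
have mgp := measurable_powR_norm mg.
have mhf m : measurable_fun setT (fun x => h x - f m x) by exact: measurable_funB.
suff : (\int[mu]_x (`|h x - f m x| `^ p)%:E)%E @[m --> \oo] --> 0%E.
  move=> /ge0_cvge0P H; have [|m _ /(_ m (leqnn m)) Hm] := H _ e e0.
    by move=> m; apply: integral_ge0 => x _; rewrite lee_fin powR_ge0.
  by exists (f m).
rewrite -[X in _ --> X](integral0 mu setT).
apply: (@dominated_cvg _ _ _ mu setT measurableT
  (fun m x => (`|h x - f m x| `^ p)%:E) _ (fun x => (2 `^ p * `|g x| `^ p)%:E)).
- by move=> m; apply/measurable_EFinP; exact: measurable_powR_norm.
- move=> x _; apply/fine_cvgP; split; first by near=> m.
  apply/cvgrPdist_le => r r0.
  have r1 : 0 < Num.min r 1 by rewrite lt_min r0 ltr01.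
  have /cvgrPdist_le /(_ _ r1) := fh x; apply: filterS => m.
  rewrite le_min => /andP[hr h1].
  rewrite sub0r normrN /= ger0_norm ?powR_ge0// (le_trans _ hr)//.
  have [->|hf0] := eqVneq `|h x - f m x| 0; first by rewrite powR0 ?gt_eqF.
  by rewrite ge1r_powR// h1 andbT lt_def hf0 normr_ge0.
- by [].
- apply/integrableP; split.
    by apply/measurable_EFinP; exact: measurable_funM.
  under eq_integral => x _ do
    rewrite /= ger0_norm ?mulr_ge0 ?powR_ge0// EFinM.
  rewrite ge0_integralZl//; last exact/measurable_EFinP.
  by rewrite lte_mul_pinfty// lee_fin powR_ge0.
- move=> m x _; rewrite /= lee_fin ger0_norm ?powR_ge0// -powRM// ge0_ler_powR//.
  + by rewrite nnegrE mulr_ge0.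
  + rewrite (le_trans (ler_normB _ _))// (ger0_norm (g0 x)) mulr_natl mulr2n.
    exact: lerD.
Unshelve. all: by end_near. Qed.

Let one_integrable : (\int[mu]_x (`|1 : R| `^ p)%:E < +oo)%E.
Proof.
under eq_integral do rewrite normr1 powR1.
by rewrite integral_cst// mul1e ltey_eq fin_num_measure.
Qed.

Lemma eq_vanishing_osc (f g : T -> R) :
  (forall x y, `|f x - f y| = `|g x - g y|) ->
  vanishing_osc f -> vanishing_osc g.
Proof.
move=> fg; have E : osc f = osc g.
  apply/funext => N; apply: eq_integral => x _.
  by apply: eq_integral => y _; rewrite fg.
by rewrite /vanishing_osc E.
Qed.

Lemma vanishing_osc_const (f : T -> R) :
  (forall x y, f x = f y) -> vanishing_osc f.
Proof.
move=> cf; have E N : osc f N = 0%E.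
  apply: integral0_eq => x _; apply: integral0_eq => y _.
  by rewrite (cf x y) subrr normr0 powR0 ?mul0r// gt_eqF.
by rewrite /vanishing_osc; under eq_fun do rewrite E; exact: cvg_cst.
Qed.

Lemma vanishing_osc_indicC (A : set T) :
  vanishing_osc \1_A -> vanishing_osc \1_(~` A).
Proof.
apply: eq_vanishing_osc => x y.
rewrite !indicE !in_setC; case: (x \in A); case: (y \in A);
  by rewrite /= ?subrr// distrC.
Qed.

Lemma vanishing_osc_indicU (A B : set T) : measurable A -> measurable B ->
  vanishing_osc \1_A -> vanishing_osc \1_B -> vanishing_osc \1_(A `|` B).
Proof.
move=> mA mB; apply: vanishing_osc_add => //.
  by apply: measurable_indic; exact: measurableU.
move=> x y; rewrite !indicE !in_setU.
case: (x \in A); case: (x \in B); case: (y \in A); case: (y \in B);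
  rewrite /= ?subrr ?subr0 ?sub0r ?normrN ?normr1 ?normr0; lra.
Qed.

(* Comparing two oscillations by conversion would unfold both double integrals. *)
Opaque osc.

(** Closure under complements and finite unions is pointwise; a countable union
    is the dominated limit of its finite subunions. *)
Lemma vanishing_osc_sigma_algebra :
  sigma_algebra setT [set A | measurable A /\ vanishing_osc (\1_A : T -> R)].
Proof.
split.
- split; first exact: measurable0.
  by apply: vanishing_osc_const => x y; rewrite !indic0.
- move=> A [mA vA]; rewrite setTD; split; first exact: measurableC.
  exact: vanishing_osc_indicC.
move=> F mvF; have mF m : measurable (F m) by have [] := mvF m.
have mU m : measurable (\bigcup_(i < m) F i) by apply: bigcup_measurable => i _.
split; first exact: bigcupT_measurable.
apply: (@vanishing_osc_dominated _ (fun m => \1_(\bigcup_(i < m) F i)) (cst 1)).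
- by apply: measurable_indic; exact: bigcupT_measurable.
- by move=> m; exact: measurable_indic.
- exact: measurable_cst.
- move=> x; have [[i _ Fix]|nF] := pselect ((\bigcup_i F i) x).
    apply: cvg_near_cst; near=> m.
    rewrite !indicE !mem_set//; first by exists i.
    by exists i => //=; near: m; exact: nbhs_infty_gt.
  apply: cvg_near_cst; near=> m; rewrite !indicE !memNset//.
  by move=> [i _ Fi]; apply: nF; exists i.
- by move=> m x; rewrite indicE ger0_norm// lern1 leq_b1.
- by move=> x; rewrite indicE ger0_norm// lern1 leq_b1.
- exact: one_integrable.
elim=> [|m IH].
  by apply: vanishing_osc_const => x y; rewrite bigcup_mkord big_ord0 !indic0.
rewrite bigcup_mkord big_ord_recr /= -bigcup_mkord.
exact: (vanishing_osc_indicU (mU m) (mF m) IH (mvF m).2).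
Unshelve. all: by end_near. Qed.

Lemma vanishing_osc_generated (G : set (set T)) :
  measurable `<=` <<s G >> ->
  (forall A, G A -> measurable A /\ vanishing_osc (\1_A : T -> R)) ->
  forall A, measurable A -> vanishing_osc (\1_A : T -> R).
Proof.
move=> mG vG A /mG GA.
have [] : [set A | measurable A /\ vanishing_osc (\1_A : T -> R)] A.
  exact: (smallest_sub vanishing_osc_sigma_algebra vG).
by [].
Qed.

Lemma vanishing_osc_sum (I : Type) (r : seq I) (f : I -> T -> R) :
  (forall i, measurable_fun setT (f i)) -> (forall i, vanishing_osc (f i)) ->
  measurable_fun setT (fun x => \sum_(i <- r) f i x) /\
  vanishing_osc (fun x => \sum_(i <- r) f i x).
Proof.
move=> mf vf; elim: r => [|i r [mS vS]].
  split; first by under eq_fun do rewrite big_nil; exact: measurable_cst.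
  by apply: vanishing_osc_const => x y; rewrite !big_nil.
have mS' : measurable_fun setT (fun x => f i x + \sum_(j <- r) f j x).
  exact: measurable_funD.
under eq_fun do rewrite big_cons; split; first exact: mS'.
apply: (vanishing_osc_add (mf i) mS mS' _ (vf i) vS) => x y.
rewrite (_ : _ - _ = (f i x - f i y) +
  (\sum_(j <- r) f j x - \sum_(j <- r) f j y)); last by ring.
exact: ler_normD.
Qed.

Import HBNNSimple.

(** A nonnegative function is the increasing limit of simple functions, which
    are combinations of indicators; the general case is the difference of the
    positive and negative parts. *)
Lemma vanishing_osc_powR_integrable (h : T -> R) :
  (forall A, measurable A -> vanishing_osc (\1_A : T -> R)) ->
  measurable_fun setT h -> (\int[mu]_x (`|h x| `^ p)%:E < +oo)%E ->
  vanishing_osc h.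
Proof.
move=> vA.
have vnn (u : T -> R) : (forall x, 0 <= u x) -> measurable_fun setT u ->
    (\int[mu]_x (`|u x| `^ p)%:E < +oo)%E -> vanishing_osc u.
  move=> u0 mu' up.
  have meu : measurable_fun setT (EFin \o u) by exact/measurable_EFinP.
  pose s := nnsfun_approx measurableT meu.
  have su x : s m x @[m --> \oo] --> u x.
    have := cvg_nnsfun_approx measurableT meu (fun x _ => u0 x) (I : [set: T] x).
    by move=> /fine_cvgP[_]; exact.
  have sle m x : s m x <= u x.
    rewrite -(cvg_lim _ (su x))//; apply: nondecreasing_cvgn_le.
      by move=> a b ab; have /lefP := nd_nnsfun_approx measurableT meu ab; exact.
    by apply/cvg_ex; exists (u x); exact: su.
  apply: (@vanishing_osc_dominated u (fun m => s m) u mu' _ mu' su _ _ up).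
  - by [].
  - by move=> m x; rewrite ger0_norm.
  - by move=> x; rewrite ger0_norm.
  move=> m.
  pose t (c : R) (x : T) := c * \1_(s m @^-1` [set c]) x.
  have mt c : measurable_fun setT (t c).
    by apply: measurable_funM => //; exact: measurable_indic.
  have vt c : vanishing_osc (t c).
    apply: vanishing_osc_scale; first exact: measurable_indic.
    exact: vA.
  have E : (fun x => \sum_(c <- finmap.enum_fset (fset_set (range (s m)))) t c x) = s m.
    by apply/funext => x; rewrite fimfunE fsbig_finite.
  have [_ vS] := vanishing_osc_sum (finmap.enum_fset (fset_set (range (s m)))) mt vt.
  by rewrite E in vS; exact: vS.
move=> mh hp.
pose hp' x := Num.max (h x) 0; pose hn x := Num.max (- h x) 0.
have mhp : measurable_fun setT hp' by exact: measurable_maxr.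
have mhn : measurable_fun setT hn.
  by apply: measurable_maxr => //; exact: measurableT_comp.
have le_int (u : T -> R) : (forall x, `|u x| <= `|h x|) ->
    (\int[mu]_x (`|u x| `^ p)%:E < +oo)%E.
  move=> uh; apply: le_lt_trans hp; apply: ge0_le_integralT => x.
    by rewrite lee_fin powR_ge0.
  by rewrite lee_fin ge0_ler_powR// nnegrE.
have p0 x : 0 <= hp' x by rewrite le_max lexx orbT.
have n0 x : 0 <= hn x by rewrite le_max lexx orbT.
have vp : vanishing_osc hp'.
  apply: (vnn _ p0 mhp); apply: le_int => x; rewrite ger0_norm//.
  by rewrite /hp' ge_max normr_ge0 ler_norm.
have vn : vanishing_osc hn.
  apply: (vnn _ n0 mhn); apply: le_int => x; rewrite ger0_norm//.
  by rewrite /hn ge_max normr_ge0 -normrN ler_norm.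
apply: (vanishing_osc_add mhp mhn mh _ vp vn) => x y.
have hE z : h z = hp' z - hn z.
  rewrite /hp' /hn; have [h0|h0] := leP 0 (h z).
    have -> : Num.max (- h z) 0 = 0 by apply/max_idPr; rewrite oppr_le0.
    by rewrite subr0.
  have -> : Num.max (- h z) 0 = - h z by apply/max_idPl; rewrite oppr_ge0 ltW.
  by rewrite sub0r opprK.
rewrite (_ : h x - h y = (hp' x - hp' y) - (hn x - hn y)); first exact: ler_normB.
by rewrite !hE; ring.
Qed.

Lemma cvg_kernel_mean (h : T -> R) :
  (forall A, measurable A -> vanishing_osc (\1_A : T -> R)) ->
  measurable_fun setT h -> (\int[mu]_x (`|h x| `^ p)%:E < +oo)%E ->
  (\int[mu]_x (`|\int[mu]_y (h y * k N x y) - h x| `^ p)%:E)%E @[N --> \oo]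
    --> 0%E.
Proof.
move=> vA mh hp; have /vanishing_oscP vh := vanishing_osc_powR_integrable vA mh hp.
apply/ge0_cvge0P.
  by move=> N; apply: integral_ge0 => x _; rewrite lee_fin powR_ge0.
move=> e e0; apply: filterS (vh e e0) => N; apply: le_trans.
apply: ge0_le_integralT => x; first by rewrite lee_fin powR_ge0.
exact: powR_jensen.
Qed.

End mean_oscillation.

(** * Lebesgue measure on R^n *)

Lemma measurable_box (R : realType) n (A : 'I_n -> set (measurableTypeR R)) :
  (forall i, measurable (A i)) ->
  measurable [set x : Rn R n | forall i, A i (tnth x i)].
Proof.
move=> mA; rewrite (_ : [set _ | _] =
    \bigcap_(i in [set: 'I_n]) ((fun x : Rn R n => tnth x i) @^-1` A i)).
  apply: fin_bigcap_measurable; first exact: finite_finset.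
  move=> i _; rewrite -[X in measurable X]setTI.
  exact: measurable_tnth.
by apply/seteqP; split=> x /= h i; [move=> _; exact: h|exact: h].
Qed.

Lemma measurable_half_space (R : realType) n (i : 'I_n) (a : R) :
  measurable [set x : Rn R n | tnth x i < a].
Proof.
rewrite -[X in measurable X]setTI.
have : measurable (`]-oo, a[%classic : set (measurableTypeR R)).
  exact: measurable_itv.
move=> /(measurable_tnth i measurableT).
by congr measurable; apply/seteqP; split => x /=; rewrite in_itv/=.
Qed.

Lemma measurable_Rn_half_space (R : realType) n :
  @measurable _ (Rn R n) `<=`
  <<s [set A | exists i a, A = [set x : Rn R n | tnth x i < a]] >>.
Proof.
set G := [set A | _].
apply: smallest_sub; first exact: smallest_sigma_algebra.
pose f (i : 'I_n) (x : Rn R n) := tnth x i.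
suff H i : preimage_set_system setT (f i) measurable `<=` <<s G >>.
  move=> A; elim/big_ind : _ => //; first by move=> B C HB HC [/HB|/HC].
  by move=> i _; exact: H.
have mR : @measurable _ (measurableTypeR R) `<=` image_set_system setT (f i) <<s G >>.
  rewrite (RGenInftyO.measurableE R); apply: smallest_sub.
    by apply: sigma_algebra_image; exact: smallest_sigma_algebra.
  move=> _ [a ->]; rewrite /image_set_system /=; apply: sub_sigma_algebra.
  by exists i, a; rewrite setTI; apply/seteqP; split => x /=; rewrite in_itv.
by move=> _ [B /mR mB <-].
Qed.

Lemma integral_lebesgueRn_prod (R : realType) n (u : 'I_n -> R -> R) :
  (forall i t, 0 <= u i t) -> (forall i, measurable_fun setT (u i)) ->
  (\int[lebesgueRn R n]_x (\prod_(i < n) u i (tnth x i))%:E =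
   \big[*%E/1%E]_(i < n) \int[lebesgue_measure]_t (u i t)%:E)%E.
Proof.
elim: n u => [|n IH] u u0 mu.
  rewrite big_ord0 /=; under eq_integral do rewrite big_ord0.
  by rewrite integral_cst//= diracT mule1.
have mprod m (v : 'I_m -> R -> R) : (forall i, measurable_fun setT (v i)) ->
    measurable_fun [set: Rn R m] (fun x => \prod_(i < m) v i (tnth x i)).
  move=> mv; apply: measurable_prod => i _.
  by apply: (measurableT_comp (mv i)); exact: measurable_tnth.
pose F (x : Rn R n.+1) := (\prod_(i < n.+1) u i (tnth x i))%:E.
have mF : measurable_fun setT F by apply/measurable_EFinP; exact: mprod.
have F0 x : (0 <= F x)%E by rewrite lee_fin prodr_ge0.
pose G (z : measurableTypeR R * Rn R n) :=
  (u ord0 z.1 * \prod_(i < n) u (lift ord0 i) (tnth z.2 i))%:E.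
transitivity (\int[@lebesgue_measure R \x lebesgueRn R n]_z G z)%E.
  transitivity (\int[pushforward (@lebesgue_measure R \x lebesgueRn R n)
      (@consRn R n)]_x F x)%E.
    apply: eq_measure_integral => [|? A _ _]; [exact: measurable_consRn|by []].
  rewrite ge0_integral_pushforward//; last exact: measurable_consRn.
  rewrite preimage_setT; apply: eq_integral => -[t y] _.
  rewrite /F /G /= big_ord_recl /= tnth0; congr (_ * _)%:E.
  by apply: eq_bigr => i _; rewrite tnthS.
have mG : measurable_fun setT G.
  apply/measurable_EFinP; apply: measurable_funM.
    by apply: (measurableT_comp (mu ord0)); exact: measurable_fst.
  by apply: (measurableT_comp (mprod _ _ (fun i => mu (lift ord0 i))));
    exact: measurable_snd.
have G0 z : (0 <= G z)%E by rewrite lee_fin mulr_ge0// prodr_ge0.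
have IH' := IH (fun i => u (lift ord0 i)) (fun i => u0 (lift ord0 i))
  (fun i => mu (lift ord0 i)).
rewrite fubini_tonelli1// big_ord_recl -IH'.
rewrite -ge0_integralZr//.
- apply: eq_integral => t _; rewrite /fubini_F /G /=.
  under eq_integral => y _ do rewrite EFinM.
  rewrite ge0_integralZl//.
  + apply/measurable_EFinP; exact: (mprod _ (fun i => u (lift ord0 i))).
  + by move=> y _; rewrite lee_fin prodr_ge0.
  + by rewrite lee_fin.
- by apply/measurable_EFinP; exact: mu.
- by move=> t _; rewrite lee_fin.
- apply: integral_ge0 => y _.
  by rewrite lee_fin prodr_ge0.
Qed.

(** * The Fejer kernel of the fractional torus *)

Section fractional_fejer_kernel.
Variables (R : realType) (n : nat) (alpha : R).
Hypothesis sin_neq0 : sin alpha != 0.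

Let half : R := side alpha / 2.
Let I : set (measurableTypeR R) := `[- half, half]%classic.

Let side_gt0 : 0 < side alpha. Proof. by rewrite normr_gt0. Qed.

Let mI : measurable I. Proof. exact: measurable_itv. Qed.

Lemma cube_box : @cube R n alpha = [set x | forall i, I (tnth x i)].
Proof.
by apply/seteqP; split=> x /= h i; have := h i; rewrite /I/= in_itv.
Qed.

Lemma measurable_cube : measurable (@cube R n alpha).
Proof. by rewrite cube_box; exact: (measurable_box (fun=> mI)). Qed.

Lemma lebesgue_cube_side : lebesgue_measure I = (side alpha)%:E.
Proof.
rewrite /I lebesgue_measure_itv/= lte_fin.
have h0 : 0 < half by rewrite divr_gt0.
rewrite ifT; last by lra.
by rewrite -EFinD /half; congr EFin; lra.
Qed.

Lemma cube_lty : (lebesgueRn R n (cube alpha) < +oo)%E.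
Proof.
rewrite cube_box (lebesgueRn_box (fun=> mI)).
by under eq_bigr do rewrite lebesgue_cube_side; rewrite prodEFin ltey.
Qed.

(** Lebesgue measure restricted to the cube, as a finite measure on the whole of
    R^n: the periodic kernel then has mass 1 at every point x, and products of this
    measure with itself need no domain. *)
Definition cube_measure : {finite_measure set (Rn R n) -> \bar R} :=
  mfrestr measurable_cube cube_lty.

Lemma integral_cube (f : Rn R n -> \bar R) : measurable_fun setT f ->
  (\int[cube_measure]_x f x = \int[lebesgueRn R n]_(x in cube alpha) f x)%E.
Proof. exact: integral_mfrestr. Qed.

Lemma integral_cube_prod (u : 'I_n -> R -> R) :
  (forall i t, 0 <= u i t) -> (forall i, measurable_fun setT (u i)) ->
  (\int[cube_measure]_x (\prod_(i < n) u i (tnth x i))%:E =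
   \big[*%E/1%E]_(i < n) \int[lebesgue_measure]_(t in I) (u i t)%:E)%E.
Proof.
move=> u0 mu; rewrite integral_cube; last first.
  apply/measurable_EFinP; apply: measurable_prod => i _.
  by apply: (measurableT_comp (mu i)); exact: measurable_tnth.
pose v i t := u i t * \1_I t.
transitivity (\int[lebesgueRn R n]_x (\prod_(i < n) v i (tnth x i))%:E)%E.
  rewrite integral_mkcond; apply: eq_integral => x _; rewrite patchE.
  case: ifPn => [|]; rewrite ?inE ?notin_setE cube_box.
    move=> xI; congr EFin; apply: eq_bigr => i _.
    by rewrite /v indicE mem_set ?mulr1//; exact: xI.
  move=> /existsNP[i nI]; rewrite (bigD1 i)//= {1}/v indicE memNset//.
  by rewrite mulr0 mul0r.
rewrite integral_lebesgueRn_prod.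
- apply: eq_bigr => i _; rewrite [RHS]integral_mkcond; apply: eq_integral => t _.
  rewrite patchE /v indicE; case: ifPn => _; first by rewrite mulr1.
  by rewrite mulr0.
- by move=> i t; rewrite mulr_ge0.
- by move=> i; apply: measurable_funM => //; exact: measurable_indic.
Qed.

Let ae_cube : {ae cube_measure, forall x, cube alpha x}.
Proof.
exists (~` cube alpha); split => //.
  by apply: measurableC; exact: measurable_cube.
by rewrite /= /mfrestr /mrestr setICl measure0.
Qed.

(** The factor |csc alpha| is the reciprocal of the length of the cell; it makes the
    mass equal to 1. *)
Definition kern1 N (t u : R) : R :=
  `|csc alpha| * fejerR N ((t - u) * csc alpha).

Lemma kern1_ge0 N t u : 0 <= kern1 N t u.
Proof. by rewrite mulr_ge0// fejerR_ge0. Qed.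

Lemma measurable_kern1 N t : measurable_fun setT (kern1 N t).
Proof.
apply: measurable_funM => //; apply: (measurableT_comp (measurable_fejerR N)).
by apply: measurable_funM => //; exact: measurable_funB.
Qed.

Let csc_side : `|csc alpha| * side alpha = 1.
Proof. by rewrite /csc /side normfV mulVf ?normr_eq0. Qed.

Lemma kern1_mass N t : (\int[lebesgue_measure]_(u in I) (kern1 N t u)%:E = 1)%E.
Proof.
under eq_integral do rewrite EFinM.
rewrite ge0_integralZl//; last 2 first.
- apply: measurable_funTS; apply/measurable_EFinP.
  apply: (measurableT_comp (measurable_fejerR N)).
  by apply: measurable_funM => //; exact: measurable_funB.
- by move=> u _; rewrite lee_fin fejerR_ge0.
by rewrite integral_fejer_cell// -EFinM csc_side.
Qed.

Lemma kern1_tail N t :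
  (\int[lebesgue_measure]_(u in I)
     (sin (pi * ((t - u) * csc alpha)) ^+ 2 * kern1 N t u)%:E <=
   (N.+1%:R^-1)%:E)%E.
Proof.
apply: (@le_trans _ _ (\int[lebesgue_measure]_(u in I)
    (`|csc alpha| * N.+1%:R^-1)%:E)%E).
  apply: ge0_le_integral => //.
  - by move=> u _; rewrite lee_fin mulr_ge0 ?sqr_ge0 ?kern1_ge0.
  - apply: measurable_funTS; apply/measurable_EFinP; apply: measurable_funM.
      apply: measurable_funX; apply: measurableT_comp; first exact: measurable_sinR.
      apply: measurable_funM => //; apply: measurable_funM => //.
      exact: measurable_funB.
    exact: measurable_kern1.
  - by move=> u _; rewrite lee_fin mulrCA ler_wpM2l// fejerR_tail.
rewrite integral_cst//.
rewrite [X in (_ * X <= _)%E](_ : _ = (side alpha)%:E); last first.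
  exact: lebesgue_cube_side.
by rewrite -EFinM lee_fin mulrAC csc_side mul1r.
Qed.

Definition kern N (x y : Rn R n) : R :=
  \prod_(i < n) kern1 N (tnth x i) (tnth y i).

Lemma kern_ge0 N x y : 0 <= kern N x y.
Proof. by apply: prodr_ge0 => i _; exact: kern1_ge0. Qed.

Lemma kern_sym N x y : kern N x y = kern N y x.
Proof.
apply: eq_bigr => i _; rewrite /kern1 -fejerR_even; congr (_ * fejerR _ _); ring.
Qed.

Lemma measurable_kern N :
  measurable_fun [set: Rn R n * Rn R n] (fun z => kern N z.1 z.2).
Proof.
apply: measurable_prod => i _; apply: measurable_funM => //.
apply: (measurableT_comp (measurable_fejerR N)); apply: measurable_funM => //.
apply: measurable_funB; apply: (measurableT_comp (measurable_tnth i)).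
  exact: measurable_fst.
exact: measurable_snd.
Qed.

Lemma kern_mass N x : (\int[cube_measure]_y (kern N x y)%:E = 1)%E.
Proof.
rewrite (integral_cube_prod (u := fun i => kern1 N (tnth x i))).
- by rewrite big1// => i _; exact: kern1_mass.
- by move=> i t; exact: kern1_ge0.
- by move=> i; exact: measurable_kern1.
Qed.

Lemma kern_tail N (x : Rn R n) (i : 'I_n) :
  (\int[cube_measure]_y
    (sin (pi * ((tnth x i - tnth y i) * csc alpha)) ^+ 2 * kern N x y)%:E <=
   (N.+1%:R^-1)%:E)%E.
Proof.
pose u (j : 'I_n) t := (if j == i
  then sin (pi * ((tnth x j - t) * csc alpha)) ^+ 2 else 1) * kern1 N (tnth x j) t.
rewrite [leLHS](_ : _ =
    \int[cube_measure]_y (\prod_(j < n) u j (tnth y j))%:E)%E; last first.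
  apply: eq_integral => y _; congr EFin.
  rewrite /kern (bigD1 i)//= [in RHS](bigD1 i)//=.
  rewrite (_ : u i _ = sin (pi * ((tnth x i - tnth y i) * csc alpha)) ^+ 2 *
    kern1 N (tnth x i) (tnth y i)); last by rewrite /u eqxx.
  rewrite -[RHS]mulrA; congr (_ * (_ * _)); apply: eq_bigr => j /negbTE ji.
  by rewrite /u ji mul1r.
rewrite integral_cube_prod.
- rewrite (bigD1 i)//= big1 ?mule1.
    by rewrite {1}/u eqxx; exact: kern1_tail.
  move=> j /negbTE ji; rewrite /u ji; under eq_integral do rewrite mul1r.
  exact: kern1_mass.
- by move=> j t; rewrite mulr_ge0 ?kern1_ge0//; case: ifP => // _; exact: sqr_ge0.
- move=> j; apply: measurable_funM; last exact: measurable_kern1.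
  case: (j == i) => //; apply: measurable_funX; apply: measurableT_comp.
    exact: measurable_sinR.
  by apply: measurable_funM => //; apply: measurable_funM => //; exact: measurable_funB.
Qed.

Lemma measurable_kern_tail (N : nat) (x : Rn R n) (i : 'I_n) : measurable_fun setT
  (fun y : Rn R n => sin (pi * ((tnth x i - tnth y i) * csc alpha)) ^+ 2 * kern N x y).
Proof.
apply: measurable_funM; last exact: (measurable_kernel measurable_kern).
apply: measurable_funX; apply: measurableT_comp; first exact: measurable_sinR.
apply: measurable_funM => //; apply: measurable_funM => //.
by apply: measurable_funB => //; exact: measurable_tnth.
Qed.

(** It vanishes exactly when x and y represent the same point of the torus. *)
Definition torus_gap (x y : Rn R n) : R :=
  \sum_(i < n) sin (pi * ((tnth x i - tnth y i) * csc alpha)) ^+ 2.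

Lemma torus_gap_ge0 x y : 0 <= torus_gap x y.
Proof. by apply: sumr_ge0 => i _; exact: sqr_ge0. Qed.

Lemma measurable_torus_gap N x :
  measurable_fun setT (fun y => torus_gap x y * kern N x y).
Proof.
rewrite (_ : (fun y => _) = fun y : Rn R n => \sum_(i < n)
  sin (pi * ((tnth x i - tnth y i) * csc alpha)) ^+ 2 * kern N x y).
  by apply: measurable_sum => i; exact: measurable_kern_tail.
by apply/funext => y; rewrite mulr_suml.
Qed.

Lemma integral_torus_gap N x :
  (\int[cube_measure]_y (torus_gap x y * kern N x y)%:E <=
   (n%:R / N.+1%:R)%:E)%E.
Proof.
under eq_integral => y _ do rewrite mulr_suml -sumEFin.
rewrite ge0_integral_sum//.
- apply: (@le_trans _ _ (\sum_(i < n) (N.+1%:R^-1)%:E)%E).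
    by apply: lee_sum => i _; exact: kern_tail.
  by rewrite sumEFin lee_fin sumr_const card_ord mulr_natl.
- by move=> i; apply/measurable_EFinP; exact: measurable_kern_tail.
- by move=> i y _; rewrite lee_fin mulr_ge0 ?sqr_ge0 ?kern_ge0.
Qed.

Lemma integral_affine_torus_gap N x (e C : R) : 0 <= e -> 0 <= C ->
  (\int[cube_measure]_y ((e + C * torus_gap x y) * kern N x y)%:E <=
   (e + C * (n%:R / N.+1%:R))%:E)%E.
Proof.
move=> e0 C0; have mk := measurable_kernel measurable_kern N x.
have mg := measurable_torus_gap N x.
rewrite [leLHS](_ : _ = \int[cube_measure]_y
    (e%:E * (kern N x y)%:E + C%:E * (torus_gap x y * kern N x y)%:E))%E; last first.
  apply: eq_integral => y _; rewrite -!EFinM -EFinD; congr EFin; ring.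
rewrite ge0_integralD//; last 4 first.
- by move=> y _; rewrite lee_fin mulr_ge0 ?kern_ge0.
- by apply/measurable_EFinP; exact: measurable_funM.
- by move=> y _; rewrite lee_fin !mulr_ge0 ?torus_gap_ge0 ?kern_ge0.
- by apply/measurable_EFinP; exact: measurable_funM.
rewrite !ge0_integralZl//; last 4 first.
- by apply/measurable_EFinP; exact: mg.
- by move=> y _; rewrite lee_fin mulr_ge0 ?torus_gap_ge0 ?kern_ge0.
- by apply/measurable_EFinP; exact: mk.
- by move=> y _; rewrite lee_fin kern_ge0.
rewrite kern_mass mule1 EFinD EFinM leeD2l// lee_wpmul2l ?lee_fin//.
exact: integral_torus_gap.
Qed.

(** A set of full measure has points close to any x: otherwise all the mass of the
    kernel would sit where the gap is at least c, which is impossible for large N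
    because the mean of the gap tends to 0. *)
Lemma ae_close_point (P : Rn R n -> Prop) (x : Rn R n) (c : R) : 0 < c ->
  {ae cube_measure, forall y, P y} -> exists2 y, P y & torus_gap x y < c.
Proof.
move=> c0 aeP; apply: contrapT => nP.
have [N HN] : exists N, n%:R / (c * N.+1%:R) < 1.
  exists (Num.truncn (n%:R / c)).
  rewrite ltr_pdivrMr ?mulr_gt0// mul1r -ltr_pdivrMl// mulrC.
  exact: truncnS_gt.
have mk := measurable_kernel measurable_kern N x.
suff : (1 <= (n%:R / (c * N.+1%:R))%:E :> \bar R)%E by rewrite lee_fin leNgt HN.
rewrite -(kern_mass N x).
apply: (@le_trans _ _ (0 + c^-1 * (n%:R / N.+1%:R))%:E); last first.
  by rewrite lee_fin add0r invfM mulrCA.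
apply: le_trans (integral_affine_torus_gap N x (lexx 0) _); last first.
  by rewrite invr_ge0 ltW.
apply: ae_ge0_le_integral => //.
- by move=> y _; rewrite lee_fin kern_ge0.
- exact/measurable_EFinP.
- move=> y _; rewrite lee_fin add0r !mulr_ge0 ?kern_ge0 ?invr_ge0 ?(ltW c0)//.
  exact: torus_gap_ge0.
- apply/measurable_EFinP; under eq_fun do rewrite add0r -mulrA.
  by apply: measurable_funM => //; exact: measurable_torus_gap.
- apply: filterS aeP => y Py _; rewrite lee_fin add0r ler_peMl ?kern_ge0//.
  rewrite mulrC ler_pdivlMr// mul1r leNgt; apply/negP => gc; apply: nP.
  by exists y.
Qed.

Lemma sin_sqr_side_separation (e : R) : 0 < e -> exists2 c : R, 0 < c &
  forall t, sin (pi * (t * csc alpha)) ^+ 2 < c ->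
    exists k : int, `|t - k%:~R * side alpha| < e.
Proof.
move=> e0; have c0 : 0 < `|csc alpha| by rewrite normr_gt0 invr_eq0.
have [c cgt0 Hc] := @sin_sqr_separation R (e * `|csc alpha|) (mulr_gt0 e0 c0).
exists c => // t /Hc[k Hk].
have {Hk} : `|t - k%:~R * sin alpha| < e.
  rewrite -(ltr_pM2r c0) -normrM.
  rewrite (_ : _ * csc alpha = t * csc alpha - k%:~R)//.
  by rewrite /csc; field.
move=> Hk; have [s0|s0] := leP 0 (sin alpha).
  by exists k; rewrite /side (ger0_norm s0).
by exists (- k); rewrite /side (ltr0_norm s0) rmorphN /= mulrNN.
Qed.

Lemma torus_gap_close (e : R) : 0 < e -> exists2 c : R, 0 < c &
  forall x y, torus_gap x y < c -> torus_close (side alpha) e x y.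
Proof.
move=> /sin_sqr_side_separation[c c0 Hc]; exists c => // x y xyc.
have H (i : 'I_n) : exists k : int, `|tnth x i - tnth y i - k%:~R * side alpha| < e.
  apply: Hc; apply: le_lt_trans xyc; rewrite /torus_gap (bigD1 i)//= lerDl.
  by apply: sumr_ge0 => j _; exact: sqr_ge0.
have [k Hk] := fin_all_exists H; exists k => i.
by rewrite tnth_mktuple opprD addrA.
Qed.

(** * Convergence in mean of order p *)

(** The endpoints of the cell are excluded because they are identified on the
    torus although they may lie on different sides of a. *)
Lemma half_space_separation (a t : R) : t != a -> - half < t < half ->
  exists2 c : R, 0 < c & forall u, I u -> (t < a) != (u < a) ->
    c <= sin (pi * ((t - u) * csc alpha)) ^+ 2.
Proof.
move=> ta /andP[th1 th2].
(* A point of the torus closer than this to t is on the same side of a, since it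
   cannot be reached across the endpoints. *)
pose e := Num.min `|t - a| (Num.min (half - t) (half + t)).
have e0 : 0 < e by rewrite !lt_min normr_gt0 subr_eq0 ta; lra.
have [c c0 Hc] := sin_sqr_side_separation e0; exists c => // u.
rewrite /I/= in_itv/= => /andP[u1 u2] tu; rewrite leNgt; apply/negP => /Hc[k Hk].
have [e1 e2 e3] : [/\ e <= `|t - a|, e <= half - t & e <= half + t].
  by split; rewrite !ge_min lexx ?orbT.
have sE : side alpha = 2 * half by rewrite /half; lra.
have tu_le : `|t - u| <= side alpha - e by rewrite ler_norml; lra.
have [k0|k0] := eqVneq k 0.
  move: Hk; rewrite k0 mul0r subr0 ltNge => /negP; apply; apply: (le_trans e1).
  move: tu; have [ta'|ta'] := ltP t a; have [ua|ua] := ltP u a; rewrite ?eqxx// => _.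
    rewrite (@ler0_norm _ (t - a)) ?(@ler0_norm _ (t - u)); lra.
  rewrite (@ger0_norm _ (t - a)) ?(@ger0_norm _ (t - u)); lra.
have k1 : side alpha <= `|k%:~R * side alpha|.
  rewrite normrM (gtr0_norm side_gt0) ler_peMl ?(ltW side_gt0)//.
  by rewrite -intr_norm ler1z -gtz0_ge1 normr_gt0.
have := ler_normD (k%:~R * side alpha - (t - u)) (t - u).
rewrite subrK distrC; lra.
Qed.

Lemma cube_measure_hyperplane (i : 'I_n) (c : R) :
  cube_measure [set x : Rn R n | tnth x i = c] = 0%E.
Proof.
pose A (j : 'I_n) : set (measurableTypeR R) := if j == i then [set c] `&` I else I.
have mA j : measurable (A j).
  by rewrite /A; case: ifP => // _; apply: measurableI => //; exact: measurable_set1.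
rewrite /= /mfrestr /mrestr (_ : _ `&` _ = [set x | forall j, A j (tnth x j)]).
  rewrite lebesgueRn_box// (bigD1 i)//= {1}/A eqxx.
  rewrite (_ : lebesgue_measure _ = 0%E) ?mul0e//.
  apply/eqP; rewrite eq_le measure_ge0 andbT -(lebesgue_measure_set1 c).
  by rewrite le_measure ?inE//; exact: measurableI.
rewrite cube_box; apply/seteqP; split => [x [/= xc xI] j|x /= xA].
  by rewrite /A; case: eqVneq => [->|_]; [split => //=|exact: xI].
split; first by have := xA i; rewrite /A eqxx => -[].
by move=> j; have := xA j; rewrite /A; case: eqVneq => [->|_]// [].
Qed.

Let ae_coord (i : 'I_n) (c : R) : {ae cube_measure, forall x : Rn R n, tnth x i != c}.
Proof.
exists [set x : Rn R n | tnth x i = c]; split.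
- rewrite -[X in measurable X]setTI.
  exact: (measurable_tnth i measurableT (measurable_set1 c)).
- exact: cube_measure_hyperplane.
- by move=> x /= /negP; rewrite negbK => /eqP.
Qed.

(** For almost every x, the points y on the other side of the half-space have a
    gap bounded below, so the inner integral is O(1/N); it is at most 1, and
    dominated convergence applies. *)
Lemma vanishing_osc_half_space (p : R) (i : 'I_n) (a : R) : 1 <= p ->
  vanishing_osc cube_measure kern p (\1_[set x : Rn R n | tnth x i < a] : Rn R n -> R).
Proof.
move=> p1; set A := [set x | _]; pose h : Rn R n -> R := \1_A.
have p0 : 0 < p by exact: lt_le_trans p1.
have mA : measurable A by exact: measurable_half_space.
have mh : measurable_fun setT h by exact: measurable_indic.
pose w N (x y : Rn R n) := `|h x - h y| `^ p * kern N x y.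
have w0 N x y : 0 <= w N x y by rewrite mulr_ge0 ?powR_ge0 ?kern_ge0.
have hle x y : `|h x - h y| `^ p <= (h x != h y)%:R.
  have [->|_] := eqVneq (h x) (h y); first by rewrite subrr normr0 powR0 ?gt_eqF.
  rewrite /h !indicE; case: (x \in A); case: (y \in A); rewrite /= ?subrr ?subr0
    ?sub0r ?normrN ?normr1 ?normr0 ?powR1 ?powR0 ?gt_eqF//.
have w1 N x y : w N x y <= kern N x y.
  rewrite -[leRHS]mul1r ler_wpM2r ?kern_ge0// (le_trans (hle x y))//.
  by rewrite lern1 leq_b1.
have mw N : measurable_fun [set: Rn R n * Rn R n] (EFin \o (fun z => w N z.1 z.2)).
  exact: (measurable_osc_integrand p measurable_kern N mh).
pose g N x := (\int[cube_measure]_y (w N x y)%:E)%E.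
have g0 N x : (0 <= g N x)%E by apply: integral_ge0 => y _; rewrite lee_fin.
have g1 N x : (g N x <= 1)%E.
  by rewrite -(kern_mass N x); apply: ge0_le_integralT => y; rewrite lee_fin.
have mg N : measurable_fun setT (g N).
  by apply: (measurable_fun_fubini_tonelli_F _ (mw N)) => z; rewrite lee_fin.
have gx x : cube alpha x -> tnth x i != a -> tnth x i != - half ->
    tnth x i != half -> g N x @[N --> \oo] --> 0%E.
  move=> Cx xa xl xr.
  have [|c c0 Hc] := half_space_separation xa.
    have := Cx i; rewrite -/half => /andP[h1 h2].
    by rewrite !lt_neqAle h1 h2 xr eq_sym xl.
  have gle N : (g N x <= (c^-1 * N.+1%:R^-1)%:E)%E.
    pose v (y : Rn R n) :=
      sin (pi * ((tnth x i - tnth y i) * csc alpha)) ^+ 2 * kern N x y.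
    have v0 y : 0 <= v y by rewrite mulr_ge0 ?sqr_ge0 ?kern_ge0.
    have mv : measurable_fun setT v by exact: measurable_kern_tail.
    apply: (@le_trans _ _ (\int[cube_measure]_y (c^-1 * v y)%:E)%E).
      apply: ae_ge0_le_integral => //.
      + by move=> y _; rewrite lee_fin.
      + apply/measurable_EFinP; apply: (measurable_kernel (k := w)) => N'.
        by apply/measurable_EFinP; exact: mw.
      + by move=> y _; rewrite lee_fin mulr_ge0// invr_ge0 ltW.
      + by apply/measurable_EFinP; exact: measurable_funM.
      + apply: filterS ae_cube => y Cy _; rewrite lee_fin mulrA ler_wpM2r ?kern_ge0//.
        apply: (le_trans (hle x y)); have [//|hxy] := eqVneq (h x) (h y).
          by move=> _; rewrite mulr_ge0 ?sqr_ge0// invr_ge0 ltW.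
        rewrite mulrC ler_pdivlMr// mul1r; apply: Hc.
          by rewrite -/(I _) -[I _]/(I (tnth y i)); move: Cy; rewrite cube_box; exact.
        apply: contraNneq hxy => E; rewrite /h !indicE.
        by have -> // : (x \in A) = (y \in A); apply/idP/idP; rewrite !inE /A /= E.
    under eq_integral do rewrite EFinM.
    rewrite ge0_integralZl//; last 3 first.
    + by apply/measurable_EFinP; exact: mv.
    + by move=> y _; rewrite lee_fin.
    + by rewrite lee_fin invr_ge0 ltW.
    by rewrite EFinM lee_pmul2l// ?lte_fin ?invr_gt0//; exact: kern_tail.
  apply/ge0_cvge0P => // e e0.
  have ec0 : 0 < e * c by exact: mulr_gt0.
  apply: filterS (near_infty_natSinv_lt (PosNum ec0)) => N /= Ne.
  by apply: (le_trans (gle N)); rewrite lee_fin mulrC ler_pdivrMr// ltW.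
have [] := @dominated_convergence _ _ _ cube_measure setT measurableT g (cst 0%E)
  (cst 1%E) mg (measurable_cst _).
- apply: filterS3 ae_cube (ae_coord i a)
    (filterI (ae_coord i (- half)) (ae_coord i half)).
  by move=> x Cx xa [xl xr] _; exact: gx.
- apply/integrableP; split; first exact: measurable_cst.
  under eq_integral do rewrite /= normr1.
  by rewrite integral_cst// mul1e ltey_eq fin_num_measure.
- by apply: aeW => x N _; rewrite gee0_abs.
- by move=> _ _; rewrite integral0; exact.
Qed.

Definition fejer_mean N (u : Rn R n -> R) (x : Rn R n) : R :=
  \int[cube_measure]_y (u y * kern N x y).

Lemma cvg_fejer_mean_powR (p : R) (u : Rn R n -> R) : 1 <= p ->
  measurable_fun setT u -> (\int[cube_measure]_x (`|u x| `^ p)%:E < +oo)%E ->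
  (\int[cube_measure]_x (`|fejer_mean N u x - u x| `^ p)%:E)%E @[N --> \oo] --> 0%E.
Proof.
move=> p1 mu up.
apply: (cvg_kernel_mean p1 kern_ge0 measurable_kern kern_sym kern_mass) => //.
apply: (vanishing_osc_generated p1 kern_ge0 measurable_kern kern_sym kern_mass
  (@measurable_Rn_half_space R n)) => _ [i [a ->]]; split.
  exact: measurable_half_space.
exact: vanishing_osc_half_space.
Qed.

Lemma measurable_fejer_mean N (u : Rn R n -> R) : measurable_fun setT u ->
  cube_measure.-integrable setT (EFin \o u) -> measurable_fun setT (fejer_mean N u).
Proof.
move=> mu iu; pose f (z : Rn R n * Rn R n) := (u z.2 * kern N z.1 z.2)%:E.
have mf : measurable_fun setT f.
  apply/measurable_EFinP; apply: measurable_funM; last exact: measurable_kern.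
  by apply: (measurableT_comp mu); exact: measurable_snd.
have imf : (cube_measure \x cube_measure)%E.-integrable setT f.
  apply: (integrable21ltyP cube_measure cube_measure mf).2; have /integrableP[_] := iu.
  congr (_ < _)%E; apply: eq_integral => y _ /=.
  under [RHS]eq_integral => x _ do
    rewrite normrM (ger0_norm (kern_ge0 _ _ _)) kern_sym EFinM.
  rewrite ge0_integralZl// ?kern_mass ?mule1//.
  - by apply/measurable_EFinP; exact: (measurable_kernel measurable_kern).
  - by move=> x _; rewrite lee_fin kern_ge0.
rewrite (_ : fejer_mean N u = fine \o fubini_F cube_measure f)//.
apply: measurableT_comp; first exact: fine_measurable.
exact: (measurable_fubini_F imf).
Qed.

Lemma fejerE N (x y : Rn R n) :
  fejer N (sub_csc alpha x y) =
  (\prod_(i < n) fejerR N ((tnth x i - tnth y i) * csc alpha))%:C%C.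
Proof.
rewrite [RHS](rmorph_prod (real_complex R)); apply: eq_bigr => i _.
by rewrite fejer1E tnth_mktuple.
Qed.

Lemma kernE N (x y : Rn R n) : kern N x y = `|csc alpha| ^+ n *
  \prod_(i < n) fejerR N ((tnth x i - tnth y i) * csc alpha).
Proof. by rewrite /kern big_split /= prodr_const card_ord. Qed.

Lemma integrable_fejer N (x : Rn R n) (u : Rn R n -> R) :
  measurable_fun setT u -> cube_measure.-integrable setT (EFin \o u) ->
  cube_measure.-integrable setT (EFin \o (fun y => u y *
    \prod_(i < n) fejerR N ((tnth x i - tnth y i) * csc alpha))).
Proof.
move=> mu iu; pose M := (1 + 2 * N%:R : R) ^+ n.
have P0 (y : Rn R n) : 0 <= \prod_(i < n) fejerR N ((tnth x i - tnth y i) * csc alpha).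
  by apply: prodr_ge0 => i _; exact: fejerR_ge0.
have M0 : 0 <= M by rewrite exprn_ge0// addr_ge0.
apply: (@le_integrable _ _ _ cube_measure setT measurableT _
  (EFin \o (fun y => M * u y))).
- apply/measurable_EFinP; apply: measurable_funM => //; apply: measurable_prod => i _.
  apply: (measurableT_comp (measurable_fejerR N)); apply: measurable_funM => //.
  by apply: measurable_funB => //; exact: measurable_tnth.
- move=> y _; rewrite /= lee_fin !normrM mulrC ler_wpM2r//.
  rewrite !ger0_norm// /M -[n in leRHS]card_ord -prodr_const.
  by apply: ler_prod => i _; rewrite fejerR_ge0 fejerR_le.
- exact: (@integrableZl _ _ _ cube_measure setT measurableT M (EFin \o u)).
Qed.

Lemma fejer_meanE N (x : Rn R n) (u v : Rn R n -> R) :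
  measurable_fun setT u -> cube_measure.-integrable setT (EFin \o u) ->
  (forall y, cube alpha y -> v y = u y *
    \prod_(i < n) fejerR N ((tnth x i - tnth y i) * csc alpha)) ->
  `|csc alpha| ^+ n * (\int[lebesgueRn R n]_(y in cube alpha) v y) = fejer_mean N u x.
Proof.
move=> mu iu vE; have iF := integrable_fejer N x mu iu.
rewrite /fejer_mean; under [RHS]eq_Rintegral => y _ do rewrite kernE mulrCA.
rewrite RintegralZl//; congr (_ * _).
rewrite (eq_Rintegral _ (g := fun y => u y *
  \prod_(i < n) fejerR N ((tnth x i - tnth y i) * csc alpha))); last first.
  by move=> y; rewrite inE => /vE.
rewrite /Rintegral; congr fine; rewrite integral_cube//.
by have /integrableP[] := iF.
Qed.

Lemma chirpK (x : Rn R n) (z : R[i]) : chirp alpha x * (chirpN alpha x * z) = z.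
Proof. by rewrite mulrA expiN mul1r. Qed.

(** The chirps of f and of the convolution cancel under the integral, and what is left
    in front has modulus 1. *)
Lemma fconv_sub_le N (f g : Rn R n -> R[i]) (x : Rn R n) :
  (forall y, cube alpha y -> f y = chirpN alpha y * g y) ->
  cmeasurable_fun setT g ->
  cube_measure.-integrable setT (EFin \o (fun y => complex.Re (g y))) ->
  cube_measure.-integrable setT (EFin \o (fun y => complex.Im (g y))) ->
  cube alpha x ->
  Normc.normc (fconv alpha f (fejer N) x - f x) <=
  `|fejer_mean N (fun y => complex.Re (g y)) x - complex.Re (g x)| +
  `|fejer_mean N (fun y => complex.Im (g y)) x - complex.Im (g x)|.
Proof.
move=> fg [mRe mIm] iRe iIm Cx.
have E y : cube alpha y -> chirp alpha y * f y * fejer N (sub_csc alpha x y) =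
    g y * (\prod_(i < n) fejerR N ((tnth x i - tnth y i) * csc alpha))%:C%C.
  by move=> Cy; rewrite fg// chirpK fejerE.
have -> : fconv alpha f (fejer N) x = chirpN alpha x *
    (fejer_mean N (fun y => complex.Re (g y)) x +i*
     fejer_mean N (fun y => complex.Im (g y)) x)%C.
  rewrite /fconv mulrAC mulrC; congr (_ * _).
  rewrite -(fejer_meanE (u := fun y => complex.Re (g y)) mRe iRe (v := fun y =>
    complex.Re (chirp alpha y * f y * fejer N (sub_csc alpha x y)))); last first.
    by move=> y /E ->; case: (g y) => a b /=; rewrite mulr0 subr0.
  rewrite -(fejer_meanE (u := fun y => complex.Im (g y)) mIm iIm (v := fun y =>
    complex.Im (chirp alpha y * f y * fejer N (sub_csc alpha x y)))); last first.
    by move=> y /E ->; case: (g y) => a b /=; rewrite mulr0 add0r.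
  rewrite /cintegral; apply/eqP; rewrite eq_complex /=.
  by rewrite !mul0r subr0 addr0 !eqxx.
rewrite fg// -mulrBr Normc.normcM normc_expi mul1r.
apply: (le_trans (normc_le_ReIm _)).
by case: (g x).
Qed.

Lemma Lp_torus_component (p : R) (g : Rn R n -> R[i]) (u : Rn R n -> R) : 1 <= p ->
  Lp_torus alpha p%:E g -> measurable_fun setT u ->
  (forall x, `|u x| <= Normc.normc (g x)) ->
  (\int[cube_measure]_x (`|u x| `^ p)%:E < +oo)%E.
Proof.
move=> p1 [_ _ gp] mu ug; have p0 : 0 < p by exact: lt_le_trans p1.
rewrite integral_cube; last first.
  by apply/measurable_EFinP; exact: measurable_powR_norm.
apply: (@le_lt_trans _ _ (Lnorm_on (lebesgueRn R n) p%:E (cube alpha) g `^ p)%E).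
  rewrite poweR_Lnorm_on//; apply: ge0_le_integral_on => x _.
    by rewrite lee_fin powR_ge0.
  by rewrite lee_fin ge0_ler_powR ?(ltW p0) ?nnegrE ?normc_ge0.
exact: poweR_lty.
Qed.

Lemma cvg_fconv_fejer_Lp (p : R) (f : Rn R n -> R[i]) : 1 <= p -> eLp alpha p%:E f ->
  Lnorm_on (lebesgueRn R n) p%:E (cube alpha)
    (fun x => fconv alpha f (fejer N) x - f x) @[N --> \oo] --> 0%E.
Proof.
move=> p1 [[g Lg fg] _]; have p0 : 0 < p by exact: lt_le_trans p1.
have [_ [mRe mIm] _] := Lg.
pose u x := complex.Re (g x); pose v x := complex.Im (g x).
have up : (\int[cube_measure]_x (`|u x| `^ p)%:E < +oo)%E.
  by apply: (Lp_torus_component p1 Lg mRe) => x; exact: (ReIm_le_normc _).1.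
have vp : (\int[cube_measure]_x (`|v x| `^ p)%:E < +oo)%E.
  by apply: (Lp_torus_component p1 Lg mIm) => x; exact: (ReIm_le_normc _).2.
have iu := integrable_powR p1 mRe up; have iv := integrable_powR p1 mIm vp.
pose A (w : Rn R n -> R) N x := `|fejer_mean N w x - w x| `^ p.
have mA w N : measurable_fun setT w -> cube_measure.-integrable setT (EFin \o w) ->
    measurable_fun setT (EFin \o A w N).
  move=> mw iw; apply/measurable_EFinP; apply: measurable_powR_norm.
  by apply: measurable_funB => //; exact: measurable_fejer_mean.
have le N : (Lnorm_on (lebesgueRn R n) p%:E (cube alpha)
     (fun x => fconv alpha f (fejer N) x - f x)%R `^ p <=
   (2 `^ p)%:E * (\int[cube_measure]_x (A u N x)%:E +
                  \int[cube_measure]_x (A v N x)%:E))%E.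
  rewrite poweR_Lnorm_on// -ge0_integralD//; last 4 first.
  - by move=> x _; rewrite lee_fin powR_ge0.
  - exact: mA.
  - by move=> x _; rewrite lee_fin powR_ge0.
  - exact: mA.
  rewrite -ge0_integralZl//; last 2 first.
  - exact: (emeasurable_funD (mA u N mRe iu) (mA v N mIm iv)).
  - by move=> x _; rewrite adde_ge0// lee_fin powR_ge0.
  rewrite integral_cube; last first.
    apply: measurable_funeM.
    exact: (emeasurable_funD (mA u N mRe iu) (mA v N mIm iv)).
  apply: ge0_le_integral_on => x Cx; first by rewrite lee_fin powR_ge0.
  rewrite -EFinD -EFinM lee_fin.
  apply: le_trans (powR_add_le (ltW p0) (normr_ge0 _) (normr_ge0 _)).
  rewrite ge0_ler_powR ?(ltW p0) ?nnegrE ?normc_ge0 ?addr_ge0//.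
  exact: fconv_sub_le.
apply/ge0_cvge0P => [N|e e0]; first exact: Lnorm_ge0.
(* Two terms bounded by r give 2^p (r + r) = e^p. *)
pose r := e `^ p / (2 `^ p * 2).
have r0 : 0 < r by rewrite divr_gt0 ?mulr_gt0 ?powR_gt0.
have /ge0_cvge0P := cvg_fejer_mean_powR p1 mRe up => /(_ _ r r0) Hu.
have /ge0_cvge0P := cvg_fejer_mean_powR p1 mIm vp => /(_ _ r r0) Hv.
apply: filterS2 (Hu _) (Hv _) => [N uN vN| |].
- have L0 := Lnorm_ge0 (lebesgueRn R n) p%:E ((fun x =>
    (Normc.normc (fconv alpha f (fejer N) x - f x))%:E) \_ (cube alpha)).
  have LE (x : \bar R) : (0 <= x)%E -> ((x `^ p) `^ p^-1 = x)%E.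
    by move=> x0; rewrite -poweRrM mulfV ?gt_eqF// poweRe1.
  rewrite -(LE (Lnorm_on _ _ _ _))// -(LE e%:E) ?lee_fin ?(ltW e0)//.
  have I0y (x : \bar R) : (x `^ p)%E \in `[0%E, +oo%E].
    by rewrite in_itv/= leey poweR_ge0.
  apply: gt0_ler_poweR; [by rewrite invr_ge0 ltW|exact: I0y|exact: I0y|].
  apply: (le_trans (le N)).
  apply: (@le_trans _ _ ((2 `^ p)%:E * (r%:E + r%:E))%E).
    by rewrite lee_pmul2l// ?lte_fin ?powR_gt0//; exact: (leeD uN vN).
  rewrite -EFinD -EFinM poweR_EFin lee_fin le_eqVlt; apply/orP; left; apply/eqP.
  by rewrite /r; field; rewrite gt_eqF ?powR_gt0.
- by move=> N; apply: integral_ge0 => x _; rewrite lee_fin powR_ge0.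
- by move=> N; apply: integral_ge0 => x _; rewrite lee_fin powR_ge0.
Qed.

(** * Uniform convergence *)

(** The usual splitting of the mean into a part near x and a part far from x is
    contained in the hypothesis: e bounds the increments near x, and far from x the
    gap is bounded below, so a multiple of it dominates them. *)
Lemma fejer_mean_bound N (u : Rn R n -> R) x (e C : R) : 0 <= e -> 0 <= C ->
  measurable_fun setT u ->
  {ae cube_measure, forall y, `|u x - u y| <= e + C * torus_gap x y} ->
  `|fejer_mean N u x - u x| <= e + C * (n%:R / N.+1%:R).
Proof.
move=> e0 C0 mu ub.
have := powR_jensen (lexx 1) kern_ge0 measurable_kern kern_mass N x mu.
rewrite powRr1// => H; rewrite -lee_fin; apply: (le_trans H).
apply: le_trans (integral_affine_torus_gap N x e0 C0).
have mk := measurable_kernel measurable_kern N x.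
apply: ae_ge0_le_integral => //.
- by move=> y _; rewrite lee_fin mulr_ge0 ?powR_ge0 ?kern_ge0.
- apply/measurable_EFinP; apply: measurable_funM => //.
  apply: (measurableT_comp (measurable_powR 1)); apply: measurableT_comp => //.
  exact: measurable_funB.
- move=> y _; rewrite lee_fin mulr_ge0 ?kern_ge0// addr_ge0// mulr_ge0//.
  exact: torus_gap_ge0.
- apply/measurable_EFinP.
  under eq_fun do rewrite mulrDl -mulrA.
  apply: measurable_funD; first exact: measurable_funM.
  by apply: measurable_funM => //; exact: measurable_torus_gap.
- apply: filterS ub => y uby _.
  by rewrite lee_fin powRr1// ler_wpM2r ?kern_ge0.
Qed.

(** Points that are close across a face of the cube have nearly opposite
    coordinates, hence nearly equal absolute values: this is why the chirp, which
    depends on the squares of the coordinates only, is continuous on the torus. *)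
Lemma torus_close_abs (e : R) (x y : Rn R n) (i : 'I_n) :
  cube alpha x -> cube alpha y -> torus_close (side alpha) e x y ->
  `| `|tnth x i| - `|tnth y i| | <= e.
Proof.
move=> Cx Cy [k] /(_ i); rewrite tnth_mktuple opprD addrA.
have /andP[] := Cx i; have /andP[] := Cy i; rewrite -/half.
have sE : side alpha = 2 * half by rewrite /half; lra.
move: (tnth x i : R) (tnth y i : R) => t u u1 u2 t1 t2 tu.
have au : `|u| <= half by rewrite ler_norml u1.
have at_ : `|t| <= half by rewrite ler_norml t1.
have [k0|k0] := eqVneq (k i) 0.
  by apply: (le_trans (ler_dist_dist _ _)); move: tu; rewrite k0 mul0r subr0 => /ltW.
have k1 : side alpha <= `|(k i)%:~R * side alpha|.
  rewrite normrM (gtr0_norm side_gt0) ler_peMl ?(ltW side_gt0)//.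
  by rewrite -intr_norm ler1z -gtz0_ge1 normr_gt0.
have H1 := ler_normD ((k i)%:~R * side alpha - (t - u)) (t - u).
rewrite subrK distrC in H1.
have H2 := ler_normB t u.
by rewrite ler_norml; lra.
Qed.

Lemma chirp_uniform (e : R) : 0 < e -> exists2 d : R, 0 < d &
  forall x y : Rn R n, cube alpha x -> cube alpha y ->
    torus_close (side alpha) d x y ->
    Normc.normc (chirp alpha x - chirp alpha y) <= e.
Proof.
move=> e0.
(* A Lipschitz constant of the chirp for the sup distance of the torus. *)
pose L := 2 * pi * `|cot alpha| * n%:R * side alpha.
have L0 : 0 <= L by rewrite !mulr_ge0 ?pi_ge0 ?(ltW side_gt0).
exists (e / (L + 1)); first by rewrite divr_gt0// ltr_wpDl.
set d := e / (L + 1) => x y Cx Cy xy.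
have sq i : `|(tnth x i : R) ^+ 2 - (tnth y i : R) ^+ 2| <= d * side alpha.
  have H := torus_close_abs i Cx Cy xy.
  have B (z : Rn R n) : cube alpha z -> `|tnth z i| <= half.
    by move=> /(_ i); rewrite ler_norml.
  rewrite -[X in `|X - _|]real_normK ?num_real// -[X in `|_ - X|]real_normK ?num_real//.
  rewrite subr_sqr normrM ler_pM// (ger0_norm (addr_ge0 _ _))//.
  have := B x Cx; have := B y Cy; rewrite /half; lra.
apply: (le_trans (expi_lipschitz _ _)).
rewrite -mulrBl -mulrBr /sqnorm -sumrB 2!normrM (ger0_norm (@pi_ge0 R)).
have S : `|\sum_(i < n) ((tnth x i : R) ^+ 2 - (tnth y i : R) ^+ 2)| <=
    n%:R * (d * side alpha).
  apply: (le_trans (ler_norm_sum _ _ _)).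
  rewrite mulr_natl -[n in leRHS]card_ord -sumr_const.
  by apply: ler_sum => i _; exact: sq.
apply: (@le_trans _ _ (L * d)); last first.
  rewrite /d mulrA ler_pdivrMr ?ltr_wpDl// mulrC ler_wpM2l ?(ltW e0)//.
  by rewrite lerDl.
rewrite (_ : L * d = 2 * (pi * (n%:R * (d * side alpha)) * `|cot alpha|)); last first.
  by rewrite /L; ring.
by rewrite ler_pM2l// ler_wpM2r// ler_wpM2l ?pi_ge0.
Qed.

Lemma ae_bounded_on_cube (h : Rn R n -> R[i]) :
  (Lnorm_on (lebesgueRn R n) +oo%E (cube alpha) h < +oo)%E ->
  exists2 M : R, 0 <= M &
    {ae cube_measure, forall x, cube alpha x /\ Normc.normc (h x) <= M}.
Proof.
have muT : (0 < lebesgueRn R n setT)%E.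
  have : (0 < lebesgueRn R n (cube alpha))%E.
    rewrite cube_box (lebesgueRn_box (fun=> mI)).
    under eq_bigr do rewrite lebesgue_cube_side.
    by rewrite prodEFin lte_fin prodr_gt0.
  move=> /lt_le_trans; apply; apply: le_measure => //; rewrite inE//.
  exact: measurable_cube.
rewrite /Lnorm_on unlock muT => hoo.
set F := (X in ess_sup _ X) in hoo.
(* As an extended real the essential supremum is not a priori nonnegative. *)
pose M := Num.max 0 (fine (ess_sup (lebesgueRn R n) F)).
exists M; first by rewrite le_max lexx.
have aeM : {ae lebesgueRn R n, forall x, (F x <= M%:E)%E}.
  apply/ess_supP; move: hoo; rewrite /M; case: (ess_sup _ F) => [r _| |_] //=.
  - by rewrite lee_fin le_max lexx orbT.
  - by rewrite leNye.
have aeM' : {ae cube_measure, forall x, (F x <= M%:E)%E}.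
  case: aeM => A [mA A0 AF]; exists A; split => //.
  apply/eqP; rewrite eq_le measure_ge0 andbT -A0 /= /mfrestr /mrestr.
  apply: le_measure; rewrite ?inE//; first exact: measurableI mA measurable_cube.
apply: filterS2 ae_cube aeM' => x Cx; rewrite /F /= patchE mem_set//= lee_fin.
by rewrite ger0_norm ?normc_ge0.
Qed.

Lemma cvg_fconv_fejer_unif (f : Rn R n -> R[i]) (K : set (Rn R n)) :
  eLp alpha +oo%E f -> K `<=` cube alpha -> unif_cont_on alpha K f ->
  Lnorm_on (lebesgueRn R n) +oo%E K
    (fun x => fconv alpha f (fejer N) x - f x) @[N --> \oo] --> 0%E.
Proof.
move=> [[g Lg fg] foo] KC fK; have [_ [mRe mIm] _] := Lg.
have [M M0 fM] := ae_bounded_on_cube foo.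
have gf x : cube alpha x -> g x = chirp alpha x * f x.
  by move=> Cx; rewrite fg// chirpK.
have gM : {ae cube_measure, forall x, Normc.normc (g x) <= M}.
  by apply: filterS fM => x [Cx]; rewrite gf// Normc.normcM normc_expi mul1r.
have ibd (w : Rn R n -> R) : measurable_fun setT w ->
    (forall x, `|w x| <= Normc.normc (g x)) ->
    cube_measure.-integrable setT (EFin \o w).
  move=> mw wg; apply/integrableP; split; first exact/measurable_EFinP.
  apply: (@le_lt_trans _ _ (\int[cube_measure]_x M%:E)%E).
    apply: ae_ge0_le_integral => //.
    - by apply/measurable_EFinP; exact: measurableT_comp.
    - by apply: filterS gM => x gx _; rewrite lee_fin; exact: le_trans gx.
  rewrite integral_cst// lte_mul_pinfty// ?lee_fin//.
  by rewrite ltey_eq fin_num_measure.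
have iRe : cube_measure.-integrable setT (EFin \o (fun y => complex.Re (g y))).
  by apply: ibd => // x; exact: (ReIm_le_normc _).1.
have iIm : cube_measure.-integrable setT (EFin \o (fun y => complex.Im (g y))).
  by apply: ibd => // x; exact: (ReIm_le_normc _).2.
(* The bound M holds almost everywhere only; continuity at the points of K extends
   it, up to 1, to every point of K. *)
have fKM x : K x -> Normc.normc (f x) <= M + 1.
  move=> Kx; have [d d0 Hd] := fK 1 ltr01.
  have [c c0 Hc] := torus_gap_close d0.
  have [y [Cy fy] /Hc xy] := ae_close_point x c0 fM.
  rewrite -(subrK (f y) (f x)) (le_trans (le_normcD _ _))// addrC lerD//.
  exact/ltW/Hd.
apply/ge0_cvge0P => [N|e e0]; first exact: Lnorm_ge0.
(* The real and imaginary parts each receive 2 e1 from the points near x, half of it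
   from f and half from the chirp, and e / 4 from the points far from x. *)
pose e1 := e / 8; have e10 : 0 < e1 by rewrite divr_gt0.
have e20 : 0 < e1 / (M + 1) by rewrite divr_gt0// ltr_wpDl.
have [d1 d10 Hd1] := fK e1 e10.
have [d2 d20 Hd2] := chirp_uniform e20.
have dm0 : 0 < Num.min d1 d2 by rewrite lt_min d10.
have [c c0 Hc] := torus_gap_close dm0.
(* When the gap is at least c, the increments of g are at most
   2 M + 1 <= C gap (x, y). *)
pose C := (2 * M + 1) / c.
have C0 : 0 <= C by rewrite divr_ge0 ?(ltW c0)// addr_ge0 ?mulr_ge0.
have osc_g x : K x -> {ae cube_measure, forall y,
    Normc.normc (g x - g y) <= 2 * e1 + C * torus_gap x y}.
  move=> Kx; have Cx := KC _ Kx; apply: filterS fM => y [Cy fy].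
  have [/Hc xy|far] := ltP (torus_gap x y) c.
    apply: (@le_trans _ _ (2 * e1)); last first.
      by rewrite lerDl mulr_ge0// torus_gap_ge0.
    have xy1 : torus_close (side alpha) d1 x y.
      have [k Hk] := xy; exists k => i; apply: lt_le_trans (Hk i) _.
      by rewrite ge_min lexx.
    have xy2 : torus_close (side alpha) d2 x y.
      have [k Hk] := xy; exists k => i; apply: lt_le_trans (Hk i) _.
      by rewrite ge_min lexx orbT.
    rewrite (gf x Cx) (gf y Cy) (_ : _ - _ = chirp alpha x * (f x - f y) +
      (chirp alpha x - chirp alpha y) * f y); last by ring.
    rewrite (le_trans (le_normcD _ _))// !Normc.normcM normc_expi mul1r.
    rewrite mulr_natl mulr2n lerD//; first by apply/ltW/Hd1.
    apply: (@le_trans _ _ (e1 / (M + 1) * (M + 1))).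
      by rewrite ler_pM ?normc_ge0 ?Hd2// (le_trans fy)// lerDl.
    by rewrite divfK// gt_eqF// ltr_wpDl.
  apply: (@le_trans _ _ (2 * M + 1)).
    rewrite (le_trans (le_normcD _ _))// normcN.
    rewrite (gf x Cx) (gf y Cy) !Normc.normcM !normc_expi !mul1r.
    by have := fKM x Kx; lra.
  apply: (@le_trans _ _ (C * torus_gap x y)); last by rewrite lerDr mulr_ge0// ltW.
  by rewrite /C mulrAC ler_pdivlMr// ler_wpM2l// addr_ge0// mulr_ge0.
have small : \forall N \near \oo, C * (n%:R / N.+1%:R) <= e / 4.
  have D0 : 0 < C * n%:R + 1 by apply: ltr_wpDl => //; exact: mulr_ge0.
  have q0 : 0 < e / 4 / (C * n%:R + 1) by rewrite !divr_gt0.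
  apply: filterS (near_infty_natSinv_lt (PosNum q0)) => N /= /ltW.
  rewrite (ler_pdivlMr _ _ D0) => H; apply: le_trans H.
  by rewrite mulrA [leLHS]mulrC ler_wpM2l ?invr_ge0// lerDl ler01.
apply: filterS small => N HN; rewrite /Lnorm_on unlock; case: ifP => _; last first.
  by rewrite lee_fin ltW.
apply/ess_supP; apply: aeW => x; rewrite /= patchE; case: ifPn => [|_]; last first.
  by rewrite /= normr0 lee_fin ltW.
rewrite inE => Kx; rewrite /= lee_fin ger0_norm ?normc_ge0//.
have Cx := KC _ Kx.
apply: (le_trans (fconv_sub_le N fg (conj mRe mIm) iRe iIm Cx)).
have B (w : Rn R n -> R) : measurable_fun setT w ->
    (forall y, `|w x - w y| <= Normc.normc (g x - g y)) ->
    `|fejer_mean N w x - w x| <= 2 * e1 + C * (n%:R / N.+1%:R).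
  move=> mw wg; apply: fejer_mean_bound => //; first by rewrite mulr_ge0// ltW.
  by apply: filterS (osc_g x Kx) => y; exact: le_trans.
have BRe := B _ mRe; have BIm := B _ mIm.
apply: (le_trans (lerD (BRe _) (BIm _))).
- by move=> y; rewrite -raddfB; exact: (ReIm_le_normc _).1.
- by move=> y; rewrite -raddfB; exact: (ReIm_le_normc _).2.
by rewrite /e1; move: (C * _) HN => q; lra.
Qed.

End fractional_fejer_kernel.

Theorem theorem2p12 (R : realType) (n : nat) (alpha : R) :
  (0 < n)%N ->
  ~ (exists k : int, alpha = k%:~R * pi) ->
  (forall (p : R) (f : Rn R n -> R[i]),
     1 <= p -> eLp alpha p%:E f ->
     (fun N : nat => Lnorm_on (lebesgueRn R n) p%:E (cube alpha)
        (fun x => fconv alpha f (fejer N) x - f x)) @ \oo --> 0%E) /\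
  (forall (f : Rn R n -> R[i]) (K : set (Rn R n)),
     eLp alpha +oo%E f -> K `<=` cube alpha -> unif_cont_on alpha K f ->
     (fun N : nat => Lnorm_on (lebesgueRn R n) +oo%E K
        (fun x => fconv alpha f (fejer N) x - f x)) @ \oo --> 0%E).
Proof.
move=> _ alphaZ; have sin_neq0 : sin alpha != 0.
  by apply/eqP => /sin_eq0_int.
split => [p f p1 fp|f K fb KC fK].
- exact: cvg_fconv_fejer_Lp.
- exact: cvg_fconv_fejer_unif.
Qed.
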